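(* Consider a discrete memoryless 3-receiver broadcast channel $p(y_1,y_2,z|x)$ in which a confidential message is to be sent to receivers $Y_1$ and $Y_2$ and kept asymptotically secret from the eavesdropper $Z$. Its secrecy capacity satisfies $$C_{\rm S}\ge\min\{I(V_0,V_1;Y_1|Q)-I(V_0,V_1;Z|Q),\ I(V_0,V_2;Y_2|Q)-I(V_0,V_2;Z|Q)\}$$ for every joint pmf of the form $p(q,v_0,v_1,v_2,x)=p(q,v_0)p(v_1,v_2|v_0)p(x|v_1,v_2,v_0)$ such that $I(V_1,V_2;Z|V_0)\le I(V_1;Z|V_0)+I(V_2;Z|V_0)-I(V_1;V_2|V_0)$, where all mutual informations are computed under $p(q,v_0,v_1,v_2,x)p(y_1,y_2,z|x)$.
   Context: The channel has finite input alphabet $\mathcal{X}$, finite output alphabets, and is used memorylessly: $p(y_1^n,y_2^n,z^n|x^n)=\prod_i p(y_{1i},y_{2i},z_i|x_i)$. A $(2^{nR},n)$ code consists of a message $M$ uniformly distributed on $[1:2^{nR}]$, a stochastic encoder that generates $X^n$ according to a conditional pmf $p(x^n|m)$, and two decoders: decoder $j\in\{1,2\}$ maps $y_j^n$ to an estimate $\hat M_j$ (or an error). The error probability is $P_e^{(n)}=\mathbb{P}\{\hat M_1\ne M\text{ or }\hat M_2\ne M\}$. A rate $R$ is achievable if there is a sequence of $(2^{nR},n)$ codes with $P_e^{(n)}\to0$ and $\liminf_{n\to\infty}\frac1n H(M|Z^n)\ge R$. The secrecy capacity $C_{\rm S}$ is the supremum of achievable rates. *)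

(* Defs.v *)
From HB Require Import structures.
From mathcomp Require Import all_boot all_order all_algebra.
From mathcomp Require Import all_classical all_reals all_analysis.
Set Implicit Arguments. Unset Strict Implicit. Unset Printing Implicit Defensive.
Import Order.TTheory GRing.Theory Num.Theory numFieldNormedType.Exports.
Local Open Scope classical_set_scope.
Local Open Scope ring_scope.

Section InfoTheory.
Variable R : realType.

Definition log2 (x : R) : R := ln x / ln 2.

Definition entropy (A : finType) (P : A -> R) : R :=
  - \sum_(a : A) (if P a == 0 then 0 else P a * log2 (P a)).

Definition pushf (T A : finType) (P : T -> R) (f : T -> A) : A -> R :=
  fun a => \sum_(t : T | f t == a) P t.

Definition Ent (T A : finType) (P : T -> R) (f : T -> A) : R :=
  entropy (pushf P f).

Definition condEnt (T A C : finType) (P : T -> R) (f : T -> A) (g : T -> C) : R :=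
  Ent P (fun t => (f t, g t)) - Ent P g.

Definition cMI (T A B C : finType) (P : T -> R)
    (f : T -> A) (g : T -> B) (k : T -> C) : R :=
  Ent P (fun t => (f t, k t)) + Ent P (fun t => (g t, k t))
  - Ent P (fun t => (f t, g t, k t)) - Ent P k.

Definition is_channel (X Y1 Y2 Z : finType) (W : X -> Y1 -> Y2 -> Z -> R) :=
  (forall x y1 y2 z, 0 <= W x y1 y2 z) /\
  (forall x, \sum_(y : Y1 * Y2 * Z) W x y.1.1 y.1.2 y.2 = 1).

Definition nmsg (n : nat) (r : R) : nat := `|Num.ceil (2 `^ (n%:R * r))|%N.

(* a (M, n) code with a stochastic encoder and two decoders (None = error) *)
Record code (X Y1 Y2 : finType) (M n : nat) := Code {
  enc : 'I_M -> n.-tuple X -> R;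
  enc_ge0 : forall m x, 0 <= enc m x;
  enc_sum1 : forall m, \sum_(x : n.-tuple X) enc m x = 1;
  dec1 : n.-tuple Y1 -> option 'I_M;
  dec2 : n.-tuple Y2 -> option 'I_M }.

Section CodeDist.
Variables (X Y1 Y2 Z : finType) (W : X -> Y1 -> Y2 -> Z -> R) (M n : nat).
Variable (c : code X Y1 Y2 M n).

Definition code_space := ('I_M * n.-tuple X * n.-tuple Y1 * n.-tuple Y2 * n.-tuple Z)%type.

Definition code_joint (t : code_space) : R :=
  let: (m, x, y1, y2, z) := t in
  M%:R^-1 * enc c m x *
  \prod_(i < n) W (tnth x i) (tnth y1 i) (tnth y2 i) (tnth z i).

Definition code_Pe : R :=
  \sum_(t : code_space | (dec1 c t.1.1.2 != Some t.1.1.1.1) ||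
                         (dec2 c t.1.2 != Some t.1.1.1.1)) code_joint t.

Definition code_equiv : R :=
  condEnt code_joint (fun t : code_space => t.1.1.1.1) (fun t : code_space => t.2).
End CodeDist.

Definition achievable (X Y1 Y2 Z : finType) (W : X -> Y1 -> Y2 -> Z -> R) (r : R) :=
  exists C : forall n : nat, code X Y1 Y2 (nmsg n r) n,
    (code_Pe W (C n) @[n --> \oo] --> (0 : R)) /\
    (r%:E <= limn_einf (fun n => ((n%:R)^-1 * code_equiv W (C n))%:E))%E.

Definition secrecy_capacity (X Y1 Y2 Z : finType) (W : X -> Y1 -> Y2 -> Z -> R)
  : \bar R := ereal_sup [set r%:E | r in [set r | achievable W r]].

Definition sl_joint (Q V0 V1 V2 X Y1 Y2 Z : finType)
  (pQV : Q -> V0 -> R) (pV : V0 -> V1 -> V2 -> R) (pX : V0 -> V1 -> V2 -> X -> R)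
  (W : X -> Y1 -> Y2 -> Z -> R)
  (t : Q * V0 * V1 * V2 * X * Y1 * Y2 * Z) : R :=
  let: (q, v0, v1, v2, x, y1, y2, z) := t in
  pQV q v0 * pV v0 v1 v2 * pX v0 v1 v2 x * W x y1 y2 z.

End InfoTheory.

(* Main.v *)
Require Import Defs.
From HB Require Import structures.
From mathcomp Require Import all_boot all_order all_algebra ring lra.
From mathcomp Require Import all_classical all_reals all_analysis.
Import Order.TTheory GRing.Theory Num.Theory.
Local Open Scope ring_scope.

Set Implicit Arguments. Unset Strict Implicit. Unset Printing Implicit Defensive.

(** By the chain rule, the assumption on [V1], [V2] says that
    [I(V1; V2 | V0, Z) <= 0], i.e. that [V1 - (V0, Z) - V2] is a Markov chain.

    Superposition codebook: each message owns [K] clouds [v0], and each cloud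
    owns [L1] satellites [v1] and [L2] satellites [v2], all drawn at random given
    a time-sharing sequence [q].  A likelihood encoder picks the triple
    [(v0, v1, v2)] of the message with probability proportional to
    [p(v1, v2 | v0) / (p(v1 | v0) p(v2 | v0))].  Under the unnormalized weights
    the chosen codewords have, on average over the codebook, exactly the law
    [p(v0, v1, v2 | q)], so decoding is analysed as for independent coding:
    receiver [j] only has to identify the message, hence
    [M K Lj < 2^(n I(V0, Vj; Yj | Q))] suffices.

    By the Markov property the weighted law of [z] given a cloud is
    [p(z | v0) A(z) B(z)], where [A] and [B] are empirical means over the two
    families of satellites of [p(z | v0, vj) / p(z | v0)].  Three soft covering
    estimates ([K > 2^(n I(V0; Z | Q))] and [Lj > 2^(n I(Vj; Z | V0))]) then make
    the law of [z] given the message close in L1 to a law independent of the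
    message.  The same L1 distance bounds the deviation of the total weight from
    [1], i.e. the cost of normalizing the encoder, and, multiplied by
    [1 + ln M = O(n)], the leaked information.  All error terms are [O(1/n)] by
    Chebyshev's inequality, which is enough for weak secrecy. *)

(** * Product laws on tuples and soft covering *)

(** Marton coding would search for a jointly typical pair of satellites, and the resulting law at Z
    is a doubly indexed average with correlated terms. The Markov property removes this obstacle:
    the likelihood weights turn the average into a product of two independent ones, so each
    satellite family is covered separately and no joint condition on [L1] and [L2] appears. All
    coding is done for a single use of an abstract channel, with free sizes and thresholds; blocks
    enter only by taking tuples as alphabets and product kernels as laws. One entry of the random
    codebook is the entire sub-codebook of a message, so distinct messages are independent and the
    dependence between clouds and satellites stays inside an entry. Error and leakage are averaged
    as one sum, hence one time-sharing sequence and one codebook are good for both. Secrecy is an L1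
    distance, so second moments suffice once likelihood ratios are truncated; the truncated tails
    are paid for separately. *)

Section IID.
Variable R : realFieldType.

Lemma eq_imp_ler (x y : R) : x = y -> x <= y.
Proof. by move=> ->. Qed.

Definition iid (n : nat) (T : finType) (p : T -> R) (t : n.-tuple T) : R :=
  \prod_(i < n) p (tnth t i).

(** Distributivity, transported from finite functions to tuples. Letting [F] depend on the index is
    what allows single coordinates to be weighted later. *)
Lemma sum_tuple_prod (n : nat) (T : finType) (F : 'I_n -> T -> R) :
  \sum_(t : n.-tuple T) \prod_(i < n) F i (tnth t i) = \prod_(i < n) \sum_a F i a.
Proof.
rewrite bigA_distr_bigA (reindex (fun f : {ffun 'I_n -> T} => [tuple f i | i < n])) /=.
  by apply: eq_bigr => f _; apply: eq_bigr => i _; rewrite tnth_mktuple.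
exists (fun t : n.-tuple T => [ffun i => tnth t i]) => [f|t] _.
  by apply/ffunP => i; rewrite ffunE tnth_mktuple.
by apply: eq_from_tnth => i; rewrite tnth_mktuple ffunE.
Qed.

Lemma iid_ge0 n (T : finType) (p : T -> R) (t : n.-tuple T) :
  (forall a, 0 <= p a) -> 0 <= iid p t.
Proof. by move=> p0; apply: prodr_ge0. Qed.

Lemma iid_sum1 n (T : finType) (p : T -> R) :
  \sum_a p a = 1 -> \sum_(t : n.-tuple T) iid p t = 1.
Proof. by move=> p1; rewrite (sum_tuple_prod (fun=> p)) big1. Qed.

Lemma iid_marg1 n (T : finType) (p : T -> R) (g : T -> R) (i : 'I_n) :
  \sum_a p a = 1 ->
  \sum_(t : n.-tuple T) iid p t * g (tnth t i) = \sum_a p a * g a.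
Proof.
move=> p1.
pose F (j : 'I_n) a := p a * (if j == i then g a else 1).
rewrite (eq_bigr (fun t : n.-tuple T => \prod_j F j (tnth t j))); last first.
  by move=> t _; rewrite big_split /= -big_mkcond big_pred1_eq.
rewrite (sum_tuple_prod F) (bigD1 i) //= [X in _ * X]big1 ?mulr1 => [|j /negbTE ji].
  by apply: eq_bigr => a _; rewrite /F eqxx.
by rewrite /F ji (eq_bigr p) // => a _; rewrite mulr1.
Qed.

Lemma iid_marg2 n (T : finType) (p : T -> R) (g h : T -> R) (i k : 'I_n) :
  \sum_a p a = 1 -> i != k ->
  \sum_(t : n.-tuple T) iid p t * (g (tnth t i) * h (tnth t k)) =
  (\sum_a p a * g a) * (\sum_a p a * h a).
Proof.
move=> p1 ik.
pose F (j : 'I_n) a := p a * ((if j == i then g a else 1) * (if j == k then h a else 1)).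
rewrite (eq_bigr (fun t : n.-tuple T => \prod_j F j (tnth t j))); last first.
  by move=> t _; rewrite big_split /= big_split /= -!big_mkcond !big_pred1_eq.
rewrite (sum_tuple_prod F) (bigD1 i) //= (bigD1 k) 1?eq_sym //=.
rewrite [X in _ * (_ * X)]big1 ?mulr1 => [|j /andP[/negbTE ji /negbTE jk]].
  by congr (_ * _); apply: eq_bigr => a _;
    rewrite /F eqxx ?[k == i]eq_sym (negbTE ik) ?mul1r ?mulr1.
by rewrite /F ji jk (eq_bigr p) // => a _; rewrite !mulr1.
Qed.

Lemma iid_avg n (T : finType) (p : T -> R) (g : T -> R) :
  (0 < n)%N -> \sum_a p a = 1 ->
  \sum_(t : n.-tuple T) iid p t * (n%:R^-1 * \sum_(i < n) g (tnth t i)) =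
  \sum_a p a * g a.
Proof.
move=> n0 p1.
under eq_bigr => t _ do rewrite mulrCA mulr_sumr.
rewrite -mulr_sumr exchange_big /=.
under eq_bigr => i _ do rewrite iid_marg1 //.
by rewrite sumr_const card_ord -[X in _ * X]mulr_natl mulKf // pnatr_eq0 -lt0n.
Qed.

(** Distinct coordinates are independent and [f] is centred, so only the diagonal of the squared sum
    survives. *)
Lemma iid_second_moment n (T : finType) (p : T -> R) (f : T -> R) :
  \sum_a p a = 1 -> \sum_a p a * f a = 0 ->
  \sum_(t : n.-tuple T) iid p t * (\sum_(i < n) f (tnth t i)) ^+ 2 =
  n%:R * \sum_a p a * f a ^+ 2.
Proof.
move=> p1 pf.
under eq_bigr => t _.
  rewrite expr2 big_distrlr /= mulr_sumr.
  under eq_bigr => i _ do rewrite mulr_sumr.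
  over.
rewrite exchange_big /=.
rewrite (eq_bigr (fun=> \sum_a p a * f a ^+ 2)); last first.
  move=> i _; rewrite exchange_big /= (bigD1 i) //= [X in _ + X]big1 ?addr0.
    by rewrite (iid_marg1 (fun a => f a * f a)).
  by move=> j ji; rewrite iid_marg2 1?eq_sym // pf mul0r.
by rewrite sumr_const card_ord mulr_natl.
Qed.

(** The probabilistic method. Positivity of the weight is recorded because the time-sharing sequence
    selected this way must lie in the support, where the Markov identity is available. *)
Lemma weighted_le_witness (T : finType) (w F : T -> R) (B : R) :
  (forall t, 0 <= w t) -> \sum_t w t = 1 -> \sum_t w t * F t <= B ->
  exists2 t, 0 < w t & F t <= B.
Proof.
move=> w0 w1 wF.
have [/existsP[t /andP[]]|] := boolP [exists t, (0 < w t) && (F t <= B)]; first by exists t.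
rewrite negb_exists => /forallP noT; exfalso.
have wge t : w t * B <= w t * F t.
  have := noT t; rewrite negb_and -leNgt -ltNge => /orP[wt|FB].
    have -> : w t = 0 by apply/eqP; rewrite eq_le wt w0.
    by rewrite !mul0r.
  by rewrite ler_wpM2l // ltW.
have seq0 : \sum_t (w t * F t - w t * B) = 0.
  apply/eqP; rewrite eq_le sumr_ge0 ?andbT; last by move=> t _; rewrite subr_ge0.
  by rewrite sumrB -mulr_suml w1 mul1r subr_le0.
have [t _ wt] : exists2 t, t \in T & 0 < w t.
  apply/exists_inP; rewrite -[X in is_true X]negbK; apply/negP => /exists_inPn H.
  have : \sum_t w t <= 0 by apply: sumr_le0 => t _; rewrite leNgt H.
  by rewrite w1 ler10.
have /eqP : w t * F t - w t * B = 0.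
  by move: seq0 => /psumr_eq0P -> // i _; rewrite subr_ge0.
rewrite -mulrBr mulf_eq0 gt_eqF //= subr_eq0 => /eqP FB.
by have := noT t; rewrite wt FB lexx.
Qed.

End IID.

Section SoftCovering.
Variable R : realFieldType.

Lemma norm_le_amgm (x s : R) : 0 < s -> `|x| <= x ^+ 2 / (2 * s) + s / 2.
Proof.
move=> s0; rewrite -real_normK ?num_real //.
rewrite -subr_ge0 (_ : _ - _ = (`|x| - s) ^+ 2 / (2 * s)); last by field; rewrite gt_eqF.
by rewrite divr_ge0 ?sqr_ge0 // mulr_ge0 // ltW.
Qed.

Variables (V Z : finType) (p : V -> R) (c : V -> Z -> R) (cb : Z -> R).
Variables (L : nat) (beta delta : R).
Hypotheses (p0 : forall v, 0 <= p v) (p1 : \sum_v p v = 1).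
Hypotheses (c0 : forall v z, 0 <= c v z) (cbE : forall z, cb z = \sum_v p v * c v z).
Hypotheses (cb1 : \sum_z cb z <= 1) (L0 : (0 < L)%N) (delta0 : 0 < delta).
Hypotheses (beta0 : 0 <= beta) (beta_le : beta <= delta ^+ 2 * L%:R).

Let cb0 z : 0 <= cb z.
Proof. by rewrite cbE; apply: sumr_ge0 => v _; rewrite mulr_ge0. Qed.

(** Truncation at likelihood ratio [beta]: the part [g] has second moment at most
    [beta * cb z ^+ 2], while the part [b] is controlled in mean only. *)
Let g v z := if c v z <= beta * cb z then c v z else 0.
Let b v z := if c v z <= beta * cb z then 0 else c v z.

(** The empirical mean has variance at most [beta * cb z ^+ 2 / L%:R], hence at most [s ^+ 2] for
    [s = cb z * delta]. With this [s], [norm_le_amgm] gives [s / 2 + s / 2]. *)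
Let soft_covering_good z :
  \sum_(t : L.-tuple V) iid p t *
     `|L%:R^-1 * \sum_(i < L) g (tnth t i) z - \sum_v p v * g v z| <= cb z * delta.
Proof.
have g0 v : 0 <= g v z by rewrite /g; case: ifP.
have LR : 0 < L%:R :> R by rewrite ltr0n.
set gb := \sum_v p v * g v z.
have [cbz|] := eqVneq (cb z) 0.
  have gz v : g v z = 0.
    rewrite /g cbz mulr0; case: ifP => // h; apply/eqP; by rewrite eq_le h c0.
  rewrite cbz mul0r big1 // => t _.
  by rewrite /gb !big1 ?mulr0 ?subr0 ?normr0 ?mulr0 // => v _; rewrite gz ?mulr0.
move=> cbn; have cbp : 0 < cb z by rewrite lt_neqAle eq_sym cbn cb0.
have s0 : 0 < cb z * delta by rewrite mulr_gt0.
pose f v := g v z - gb.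
have pf : \sum_a p a * f a = 0.
  by under eq_bigr do rewrite mulrBr; rewrite sumrB -mulr_suml p1 mul1r subrr.
have avgE (t : L.-tuple V) :
    L%:R^-1 * \sum_(i < L) g (tnth t i) z - gb = L%:R^-1 * \sum_(i < L) f (tnth t i).
  rewrite sumrB sumr_const card_ord mulrBr -[gb *+ L]mulr_natl mulKf //.
  by rewrite gt_eqF.
have pf2 : \sum_a p a * f a ^+ 2 <= beta * cb z ^+ 2.
  have -> : \sum_a p a * f a ^+ 2 = \sum_a p a * g a z ^+ 2 - gb ^+ 2.
    rewrite /f; under eq_bigr => a _.
      rewrite (_ : _ * _ = p a * g a z ^+ 2 - (2 * gb) * (p a * g a z) + gb ^+ 2 * p a); last by ring.
      over.
    by rewrite big_split /= sumrB -!mulr_sumr p1 -/gb; ring.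
  apply: (@le_trans _ _ (\sum_a p a * g a z ^+ 2)); first by rewrite gerBl sqr_ge0.
  apply: (@le_trans _ _ (\sum_a (beta * cb z) * (p a * c a z))); last first.
    by rewrite -mulr_sumr -cbE; apply: eq_imp_ler; ring.
  apply: ler_sum => a _.
  rewrite [leRHS]mulrCA ler_wpM2l // /g; case: ifP => [h|_]; last by rewrite expr0n mulr_ge0 ?mulr_ge0.
  by rewrite expr2 ler_wpM2r.
apply: (@le_trans _ _ (\sum_(t : L.-tuple V) iid p t *
   ((L%:R^-1 * \sum_(i < L) f (tnth t i)) ^+ 2 / (2 * (cb z * delta)) + cb z * delta / 2))).
  by apply: ler_sum => t _; rewrite avgE ler_wpM2l ?iid_ge0 // norm_le_amgm.
under eq_bigr => t _.
  rewrite mulrDr exprMn (_ : iid p t * _ = (L%:R^-1 ^+ 2 / (2 * (cb z * delta))) *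
     (iid p t * (\sum_(i < L) f (tnth t i)) ^+ 2)); last by ring.
  over.
rewrite big_split /= -mulr_sumr -mulr_suml iid_sum1 // mul1r iid_second_moment //.
rewrite [leRHS](_ : _ = cb z * delta / 2 + cb z * delta / 2); last by field.
rewrite lerD2r.
apply: (@le_trans _ _ (L%:R^-1 ^+ 2 / (2 * (cb z * delta)) * (L%:R * ((delta ^+ 2 * L%:R) * cb z ^+ 2)))).
  apply: ler_wpM2l.
    by rewrite divr_ge0 ?exprn_ge0 ?invr_ge0 ?mulr_ge0 // ltW.
  apply: ler_wpM2l; first exact: ltW.
  by apply: (le_trans pf2); rewrite ler_wpM2r ?exprn_ge0.
apply: eq_imp_ler; field.
by rewrite !gt_eqF.
Qed.

(** The truncated mass is charged twice, once in the empirical mean and once in the true mean,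
    whence the factor 2; the rest fluctuates by [delta * cb z] at each [z]. *)
Lemma soft_covering :
  \sum_(t : L.-tuple V) iid p t * \sum_z `|L%:R^-1 * \sum_(i < L) c (tnth t i) z - cb z|
  <= 2 * (\sum_v \sum_z p v * c v z * (beta * cb z < c v z)%R%:R) + delta.
Proof.
have cgb v z : c v z = g v z + b v z by rewrite /g /b; case: ifP; rewrite ?addr0 ?add0r.
have b0 v z : 0 <= b v z by rewrite /b; case: ifP.
have bE v z : b v z = c v z * (beta * cb z < c v z)%R%:R.
  by rewrite /b ltNge; case: ifP; rewrite ?mulr0 ?mulr1.
under eq_bigr do rewrite mulr_sumr.
rewrite exchange_big /=.
have step z : \sum_(t : L.-tuple V) iid p t * `|L%:R^-1 * \sum_(i < L) c (tnth t i) z - cb z| <=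
   2 * (\sum_v p v * b v z) + cb z * delta.
  apply: (@le_trans _ _ (\sum_(t : L.-tuple V) (iid p t *
     `|L%:R^-1 * \sum_(i < L) g (tnth t i) z - \sum_v p v * g v z| +
     iid p t * (L%:R^-1 * \sum_(i < L) b (tnth t i) z) +
     iid p t * (\sum_v p v * b v z)))).
    apply: ler_sum => t _; rewrite -!mulrDr ler_wpM2l ?iid_ge0 //.
    rewrite cbE; under eq_bigr do rewrite cgb.
    under [X in _ - X]eq_bigr do rewrite cgb mulrDr.
    rewrite !big_split /= mulrDr.
    set x1 := L%:R^-1 * \sum_(i < L) g _ _; set x2 := L%:R^-1 * \sum_(i < L) b _ _.
    set y1 := \sum_v _; set y2 := \sum_v _.
    have x20 : 0 <= x2 by rewrite mulr_ge0 ?invr_ge0 ?sumr_ge0 // ltW.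
    have y20 : 0 <= y2 by rewrite sumr_ge0 // => v _; rewrite mulr_ge0.
    rewrite (_ : _ - _ = (x1 - y1) + x2 + - y2); last by ring.
    rewrite (le_trans (ler_normD _ _)) // (le_trans (lerD (ler_normD _ _) (lexx _))) //.
    by rewrite normrN (ger0_norm x20) (ger0_norm y20).
  rewrite !big_split /= (iid_avg (fun a => b a z)) // -mulr_suml iid_sum1 // mul1r.
  have := soft_covering_good z; lra.
apply: (le_trans (ler_sum _ (fun z _ => step z))).
rewrite big_split /= -mulr_sumr -mulr_suml exchange_big /=.
apply: lerD; last by rewrite ger_pMl.
rewrite ler_pM2l //; apply: ler_sum => v _; apply: ler_sum => z _.
by rewrite bE mulrA.
Qed.

End SoftCovering.

(** * Random codes with a normalized ideal encoder *)

Section Decoding.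
Variables (R : realFieldType) (S Y : finType) (M : nat).

(** An entry of [B] will be the whole sub-codebook of a message, so uniqueness is asked of messages
    and not of codewords inside one message. *)
Definition unique_dec (tau : S -> Y -> bool) (B : M.-tuple S) (y : Y) : option 'I_M :=
  [pick m | tau (tnth B m) y && [forall m', (m' != m) ==> ~~ tau (tnth B m') y]].

Lemma unique_dec_err tau (B : M.-tuple S) y m :
  (unique_dec tau B y != Some m)%:R <=
  (~~ tau (tnth B m) y)%:R + \sum_(m' < M | m' != m) (tau (tnth B m') y)%:R :> R.
Proof.
have sum0 : 0 <= \sum_(m' < M | m' != m) (tau (tnth B m') y)%:R :> R.
  by apply: sumr_ge0 => m' _; rewrite ler0n.
have [tm|_] := boolP (tau (tnth B m) y); last by case: eqP => _ /=; lra.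
have [/existsP[m' /andP[m'm tm']]|] := boolP [exists m', (m' != m) && tau (tnth B m') y].
  rewrite add0r (bigD1 m') //= tm' (@le_trans _ _ 1) //; first by rewrite lern1 leq_b1.
  by rewrite lerDl sumr_ge0 // => k _; rewrite ler0n.
rewrite negb_exists => /forallP no.
suff -> : unique_dec tau B y = Some m by rewrite eqxx add0r.
rewrite /unique_dec; case: pickP => [k /andP[tk _]|/(_ m)].
  have [-> //|km] := eqVneq k m.
  by have := no k; rewrite km tk.
rewrite tm /=; case/forallP => k; apply/implyP => km.
by have := no k; rewrite km.
Qed.

(** Entries of different messages are independent, so the weight of the output under the sent entry
    and the test of a competing entry average separately at each [y]; a union over at most [M]
    competitors follows. Here [h] is an unnormalized output law, as the ideal encoder produces. *)
Lemma decoding_error (ps : S -> R) (tau : S -> Y -> bool) (h : S -> Y -> R) :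
  (forall s, 0 <= ps s) -> \sum_s ps s = 1 -> (forall s y, 0 <= h s y) -> (0 < M)%N ->
  \sum_(B : M.-tuple S) iid ps B *
     (M%:R^-1 * \sum_(m < M) \sum_y h (tnth B m) y * (unique_dec tau B y != Some m)%:R)
  <= \sum_s ps s * (\sum_y h s y * (~~ tau s y)%:R) +
     M%:R * (\sum_y (\sum_s ps s * h s y) * (\sum_s ps s * (tau s y)%:R)).
Proof.
move=> ps0 ps1 h0 M0.
have MR : 0 < M%:R :> R by rewrite ltr0n.
apply: (@le_trans _ _ (\sum_(B : M.-tuple S) (iid ps B *
   (M%:R^-1 * \sum_(m < M) \sum_y h (tnth B m) y * (~~ tau (tnth B m) y)%:R) +
   \sum_(m < M) \sum_(m' < M | m' != m) \sum_y M%:R^-1 *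
       (iid ps B * (h (tnth B m) y * (tau (tnth B m') y)%:R))))).
  apply: ler_sum => B _.
  have -> : \sum_(m < M) \sum_(m' < M | m' != m) \sum_y M%:R^-1 *
       (iid ps B * (h (tnth B m) y * (tau (tnth B m') y)%:R)) =
     iid ps B * (M%:R^-1 * \sum_(m < M) \sum_y h (tnth B m) y *
       \sum_(m' < M | m' != m) (tau (tnth B m') y)%:R).
    rewrite mulrCA !mulr_sumr; apply: eq_bigr => m _.
    rewrite exchange_big /= !mulr_sumr; apply: eq_bigr => y _.
    by rewrite -!mulr_sumr.
  rewrite -!mulrDr -big_split /=.
  apply: ler_wpM2l; first exact: iid_ge0.
  apply: ler_wpM2l; first by rewrite invr_ge0 ltW.
  apply: ler_sum => m _; rewrite -big_split /=; apply: ler_sum => y _.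
  by rewrite -mulrDr ler_wpM2l // unique_dec_err.
rewrite big_split /= (iid_avg (fun s => \sum_y h s y * (~~ tau s y)%:R)) //.
rewrite lerD2l exchange_big /=.
set c := \sum_y (\sum_s ps s * h s y) * (\sum_s ps s * (tau s y)%:R).
have c0 : 0 <= c.
  by apply: sumr_ge0 => y _; apply: mulr_ge0; apply: sumr_ge0 => s _; rewrite mulr_ge0 ?ler0n.
apply: (@le_trans _ _ (\sum_(m < M) \sum_(m' < M) M%:R^-1 * c)); last first.
  rewrite !sumr_const card_ord -[leLHS]mulr_natl -[_ * c *+ M]mulr_natl mulVKf //.
  by rewrite gt_eqF.
apply: ler_sum => m _.
rewrite exchange_big /= big_mkcond /=; apply: ler_sum => m' _.
case: ifP => mm'; last by rewrite mulr_ge0 // invr_ge0 ltW.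
rewrite exchange_big /= mulr_sumr; apply: ler_sum => y _.
rewrite -mulr_sumr (iid_marg2 (fun s => h s y) (fun s => (tau s y)%:R)) //.
by rewrite eq_sym.
Qed.

End Decoding.

Section RandomCoding.
Variables (R : realFieldType) (X Y1 Y2 Z S : finType) (M : nat).
Variables (ps : S -> R) (W : X -> Y1 -> Y2 -> Z -> R) (idl : S -> X -> R).
Variables (tau1 : S -> Y1 -> bool) (tau2 : S -> Y2 -> bool) (pz : Z -> R) (x0 : X).
Hypotheses (ps0 : forall s, 0 <= ps s) (ps1 : \sum_s ps s = 1).
Hypotheses (W0 : forall x y1 y2 z, 0 <= W x y1 y2 z).
Hypotheses (W1 : forall x, \sum_y1 \sum_y2 \sum_z W x y1 y2 z = 1).
Hypotheses (idl0 : forall s x, 0 <= idl s x) (pz1 : \sum_z pz z = 1) (M0 : (0 < M)%N).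

Definition chY1 (x : X) (y1 : Y1) : R := \sum_y2 \sum_z W x y1 y2 z.
Definition chY2 (x : X) (y2 : Y2) : R := \sum_y1 \sum_z W x y1 y2 z.
Definition chZ (x : X) (z : Z) : R := \sum_y1 \sum_y2 W x y1 y2 z.

(** A codebook of zero total mass is sent to the default input [x0]. This is harmless: [leak s] is
    then at least 1, as [pz] sums to one. *)
Definition normalized_enc (s : S) (x : X) : R :=
  if \sum_x idl s x == 0 then (x == x0)%:R else idl s x / \sum_x idl s x.

Definition leak (s : S) : R := \sum_z `|\sum_x idl s x * chZ x z - pz z|.

Definition code_error (enc : 'I_M -> X -> R) (d1 : Y1 -> option 'I_M) (d2 : Y2 -> option 'I_M) :=
  M%:R^-1 * \sum_m \sum_x enc m x * \sum_y1 \sum_y2 \sum_z W x y1 y2 z *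
     ((d1 y1 != Some m) || (d2 y2 != Some m))%:R.

Definition code_leak (enc : 'I_M -> X -> R) : R :=
  M%:R^-1 * \sum_m \sum_z `|\sum_x enc m x * chZ x z - pz z|.

Lemma chZ_sum1 x : \sum_z chZ x z = 1.
Proof.
rewrite exchange_big -[RHS](W1 x); apply: eq_bigr => y1 _; exact: exchange_big.
Qed.

Lemma chZ_ge0 x z : 0 <= chZ x z.
Proof. by do 2! apply: sumr_ge0 => ? _. Qed.

Lemma chY1_ge0 x y : 0 <= chY1 x y.
Proof. by do 2! apply: sumr_ge0 => ? _. Qed.

Lemma chY2_ge0 x y : 0 <= chY2 x y.
Proof. by do 2! apply: sumr_ge0 => ? _. Qed.

Lemma normalized_enc_ge0 s x : 0 <= normalized_enc s x.
Proof. by rewrite /normalized_enc; case: ifP => _; rewrite ?ler0n ?divr_ge0 ?sumr_ge0. Qed.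

Lemma normalized_enc_sum1 s : \sum_x normalized_enc s x = 1.
Proof.
rewrite /normalized_enc; have [_|s0] := boolP (\sum_x idl s x == 0) => /=.
  by rewrite (bigD1 x0) //= eqxx [X in _ + X]big1 ?addr0 // => x /negbTE ->.
by rewrite -mulr_suml mulfV.
Qed.

(* The total mass of [idl s] is that of its output at [Z]. *)
Lemma normalized_enc_dist s : \sum_x `|normalized_enc s x - idl s x| <= leak s.
Proof.
apply: (@le_trans _ _ `|1 - \sum_x idl s x|).
  rewrite /normalized_enc; have [/eqP s0|s0] := boolP (\sum_x idl s x == 0) => /=.
    rewrite s0 subr0 normr1.
    have z0 x : idl s x = 0 by move/psumr_eq0P : s0; apply.
    rewrite (bigD1 x0) //= eqxx [X in _ + X]big1 ?addr0 ?z0 ?subr0 ?normr1 // => x /negbTE ->.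
    by rewrite z0 subr0 normr0.
  have sg : 0 < \sum_x idl s x by rewrite lt_neqAle eq_sym s0 sumr_ge0.
  apply: eq_imp_ler.
  transitivity (\sum_x idl s x * (`|1 - \sum_x idl s x| / \sum_x idl s x)).
    apply: eq_bigr => x _; move: s0 sg; set sg := \sum_x idl s x => s0 sg_gt0.
    rewrite (_ : _ / _ - _ = idl s x * ((1 - sg) / sg)); last by field.
    by rewrite normrM normrM normfV (ger0_norm (idl0 _ _)) (gtr0_norm sg_gt0).
  by rewrite -mulr_suml mulrCA mulfV // mulr1.
have -> : 1 - \sum_x idl s x = - \sum_z (\sum_x idl s x * chZ x z - pz z).
  rewrite sumrB pz1 opprB; congr (_ - _).
  rewrite exchange_big; apply: eq_bigr => x _ /=.
  by rewrite -mulr_sumr chZ_sum1 mulr1.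
by rewrite normrN ler_norm_sum.
Qed.

(** Passing through [chZ] does not increase L1 distance, so normalizing the encoder costs a second
    [leak] on top of that of the ideal output. *)
Lemma normalized_code_leak (B : M.-tuple S) :
  code_leak (fun m => normalized_enc (tnth B m)) <=
  2 * (M%:R^-1 * \sum_(m < M) leak (tnth B m)).
Proof.
rewrite mulrCA; apply: ler_wpM2l; first by rewrite invr_ge0 ler0n.
rewrite mulr_sumr; apply: ler_sum => m _; set s := tnth B m.
rewrite [leRHS](_ : _ = leak s + leak s); last by ring.
apply: (@le_trans _ _ (\sum_z (\sum_x `|normalized_enc s x - idl s x| * chZ x z +
   `|\sum_x idl s x * chZ x z - pz z|))).
  apply: ler_sum => z _.
  rewrite (_ : _ - _ = (\sum_x (normalized_enc s x - idl s x) * chZ x z) +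
     (\sum_x idl s x * chZ x z - pz z)); last first.
    under [X in _ = X + _]eq_bigr do rewrite mulrBl.
    by rewrite sumrB; ring.
  rewrite (le_trans (ler_normD _ _)) // lerD2r (le_trans (ler_norm_sum _ _ _)) //.
  by apply: ler_sum => x _; rewrite normrM (ger0_norm (chZ_ge0 _ _)).
rewrite big_split /= lerD2r exchange_big /= (le_trans _ (normalized_enc_dist s)) //.
by apply: ler_sum => x _; rewrite -mulr_sumr chZ_sum1 mulr1.
Qed.

(** An error probability is at most 1, so replacing the normalized encoder by the ideal one costs
    its L1 distance; the two receivers are then separated by a union bound. *)
Lemma normalized_code_error (B : M.-tuple S) d1 d2 :
  code_error (fun m => normalized_enc (tnth B m)) d1 d2 <=
  M%:R^-1 * (\sum_(m < M) leak (tnth B m)) +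
  (M%:R^-1 * (\sum_(m < M) \sum_y (\sum_x idl (tnth B m) x * chY1 x y) * (d1 y != Some m)%:R) +
   M%:R^-1 * (\sum_(m < M) \sum_y (\sum_x idl (tnth B m) x * chY2 x y) * (d2 y != Some m)%:R)).
Proof.
rewrite -!mulrDr; apply: ler_wpM2l; first by rewrite invr_ge0 ler0n.
rewrite -!big_split /=; apply: ler_sum => m _; set s := tnth B m.
pose e x := \sum_y1 \sum_y2 \sum_z W x y1 y2 z * ((d1 y1 != Some m) || (d2 y2 != Some m))%:R.
have e0 x : 0 <= e x by do 3! apply: sumr_ge0 => ? _; rewrite mulr_ge0 ?ler0n.
have e1 x : e x <= 1.
  rewrite -(W1 x); do 3! apply: ler_sum => ? _.
  by rewrite ler_piMr // lern1 leq_b1.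
have e12 x : e x <= \sum_y chY1 x y * (d1 y != Some m)%:R + \sum_y chY2 x y * (d2 y != Some m)%:R.
  rewrite /chY2; under [X in _ + X]eq_bigr do rewrite mulr_suml.
  rewrite [X in _ + X]exchange_big /= -big_split /=; apply: ler_sum => y1 _.
  rewrite mulr_suml -big_split /=; apply: ler_sum => y2 _.
  rewrite !mulr_suml -big_split /=; apply: ler_sum => z _.
  rewrite -mulrDr; apply: ler_wpM2l => //.
  by case: eqP; case: eqP => /= _ _; lra.
apply: (@le_trans _ _ (\sum_x (`|normalized_enc s x - idl s x| + idl s x * e x))).
  apply: ler_sum => x _; rewrite -lerBlDr -mulrBl.
  rewrite (le_trans (ler_norm _)) // normrM (ger0_norm (e0 x)).
  by rewrite ler_piMr.
rewrite big_split /=; apply: lerD; first exact: normalized_enc_dist.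
under [X in _ <= X + _]eq_bigr do rewrite mulr_suml.
under [X in _ <= _ + X]eq_bigr do rewrite mulr_suml.
rewrite [X in _ <= X + _]exchange_big [X in _ <= _ + X]exchange_big -big_split /=.
apply: ler_sum => x _.
under [X in _ <= X + _]eq_bigr do rewrite -mulrA.
under [X in _ <= _ + X]eq_bigr do rewrite -mulrA.
by rewrite -!mulr_sumr -mulrDr ler_wpM2l.
Qed.

(** The coefficient 3 collects one [leak] from the error and two from the leakage. *)
Definition random_coding_bound : R :=
   3 * (\sum_s ps s * leak s) +
   ((\sum_s ps s * (\sum_y (\sum_x idl s x * chY1 x y) * (~~ tau1 s y)%:R) +
     M%:R * (\sum_y (\sum_s ps s * (\sum_x idl s x * chY1 x y)) *
                    (\sum_s ps s * (tau1 s y)%:R))) +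
    (\sum_s ps s * (\sum_y (\sum_x idl s x * chY2 x y) * (~~ tau2 s y)%:R) +
     M%:R * (\sum_y (\sum_s ps s * (\sum_x idl s x * chY2 x y)) *
                    (\sum_s ps s * (tau2 s y)%:R)))).

(** Averaging the sum of error and leakage, rather than each one, makes a single codebook serve both
    purposes. *)
Lemma random_coding :
  exists (enc : 'I_M -> X -> R) (d1 : Y1 -> option 'I_M) (d2 : Y2 -> option 'I_M),
  [/\ forall m x, 0 <= enc m x, forall m, \sum_x enc m x = 1 &
  code_error enc d1 d2 + code_leak enc <= random_coding_bound].
Proof.
pose F (B : M.-tuple S) := 3 * (M%:R^-1 * \sum_(m < M) leak (tnth B m)) +
   (M%:R^-1 * (\sum_(m < M) \sum_y (\sum_x idl (tnth B m) x * chY1 x y) *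
         (unique_dec tau1 B y != Some m)%:R) +
    M%:R^-1 * (\sum_(m < M) \sum_y (\sum_x idl (tnth B m) x * chY2 x y) *
         (unique_dec tau2 B y != Some m)%:R)).
have avgF : \sum_(B : M.-tuple S) iid ps B * F B <= random_coding_bound.
  under eq_bigr do rewrite !mulrDr mulrCA.
  rewrite !big_split /= -mulr_sumr iid_avg // lerD2l.
  apply: lerD; apply: decoding_error => // s y; apply: sumr_ge0 => x _;
    by rewrite mulr_ge0 ?chY1_ge0 ?chY2_ge0.
have [B _ HB] := weighted_le_witness (fun B => iid_ge0 B ps0) (iid_sum1 _ ps1) avgF.
exists (fun m => normalized_enc (tnth B m)), (unique_dec tau1 B), (unique_dec tau2 B).
split; [by move=> *; apply: normalized_enc_ge0|by move=> *; apply: normalized_enc_sum1|].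
apply: le_trans HB; apply: (le_trans (lerD (normalized_code_error _ _ _) (normalized_code_leak _))).
by apply: eq_imp_ler; rewrite /F; ring.
Qed.

End RandomCoding.

(** * One-shot superposition coding *)

Lemma sum_prod (R : nmodType) (A B : finType) (F : A * B -> R) :
  \sum_p F p = \sum_a \sum_b F (a, b).
Proof. by rewrite pair_bigA; apply: eq_bigr => -[]. Qed.

Section Kernels.
Variables (R : realFieldType) (V0 V1 V2 X : finType).
Variables (k12 : V0 -> V1 -> V2 -> R) (kX : V0 -> V1 -> V2 -> X -> R).

Definition marg1 (v0 : V0) (v1 : V1) : R := \sum_v2 k12 v0 v1 v2.
Definition marg2 (v0 : V0) (v2 : V2) : R := \sum_v1 k12 v0 v1 v2.

Section Output.
Variables (Y : finType) (ch : X -> Y -> R).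

(* [out v0 v1 v2 y] is [p(y | v0, v1, v2)]; [outj], [outj1], [outj2] and [outj0]
   are [p(v1, v2, y | v0)] and its marginals. *)
Definition out (v0 : V0) (v1 : V1) (v2 : V2) (y : Y) : R := \sum_x kX v0 v1 v2 x * ch x y.
Definition outj v0 v1 v2 y : R := k12 v0 v1 v2 * out v0 v1 v2 y.
Definition outj1 v0 v1 y : R := \sum_v2 outj v0 v1 v2 y.
Definition outj2 v0 v2 y : R := \sum_v1 outj v0 v1 v2 y.
Definition outj0 v0 y : R := \sum_v1 outj1 v0 v1 y.
Definition outm (k0 : V0 -> R) y : R := \sum_v0 k0 v0 * outj0 v0 y.

Hypotheses (k120 : forall v0 v1 v2, 0 <= k12 v0 v1 v2).
Hypotheses (kX0 : forall v0 v1 v2 x, 0 <= kX v0 v1 v2 x).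
Hypotheses (ch0 : forall x y, 0 <= ch x y).

Lemma out_ge0 v0 v1 v2 y : 0 <= out v0 v1 v2 y.
Proof. by apply: sumr_ge0 => x _; rewrite mulr_ge0. Qed.

Lemma outj_ge0 v0 v1 v2 y : 0 <= outj v0 v1 v2 y.
Proof. by rewrite mulr_ge0 // out_ge0. Qed.

Lemma outj1_ge0 v0 v1 y : 0 <= outj1 v0 v1 y.
Proof. by apply: sumr_ge0 => *; apply: outj_ge0. Qed.

Lemma outj2_ge0 v0 v1 y : 0 <= outj2 v0 v1 y.
Proof. by apply: sumr_ge0 => *; apply: outj_ge0. Qed.

Lemma outj0_ge0 v0 y : 0 <= outj0 v0 y.
Proof. by apply: sumr_ge0 => *; apply: outj1_ge0. Qed.

Lemma outj0E2 v0 y : outj0 v0 y = \sum_v2 outj2 v0 v2 y.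
Proof. exact: exchange_big. Qed.

Lemma outj1_le_outj0 v0 v1 y : outj1 v0 v1 y <= outj0 v0 y.
Proof.
by rewrite /outj0 (bigD1 v1) //= lerDl sumr_ge0 // => *; apply: outj1_ge0.
Qed.

Lemma marg1_ge0 v0 v1 : 0 <= marg1 v0 v1.
Proof. exact: sumr_ge0. Qed.

Lemma marg2_ge0 v0 v2 : 0 <= marg2 v0 v2.
Proof. exact: sumr_ge0. Qed.

Lemma marg1_eq0 v0 v1 v2 : marg1 v0 v1 = 0 -> k12 v0 v1 v2 = 0.
Proof. by move/psumr_eq0P; apply. Qed.

Lemma marg2_eq0 v0 v1 v2 : marg2 v0 v2 = 0 -> k12 v0 v1 v2 = 0.
Proof. by move/psumr_eq0P; apply. Qed.

Lemma outj1_eq0 v0 v1 y : marg1 v0 v1 = 0 -> outj1 v0 v1 y = 0.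
Proof. by move=> h; apply: big1 => v2 _; rewrite /outj marg1_eq0 // mul0r. Qed.

Lemma outj2_eq0 v0 v2 y : marg2 v0 v2 = 0 -> outj2 v0 v2 y = 0.
Proof. by move=> h; apply: big1 => v1 _; rewrite /outj marg2_eq0 // mul0r. Qed.

Hypotheses (kX1 : forall v0 v1 v2, \sum_x kX v0 v1 v2 x = 1).
Hypotheses (ch1 : forall x, \sum_y ch x y = 1).

Lemma out_sum1 v0 v1 v2 : \sum_y out v0 v1 v2 y = 1.
Proof.
rewrite exchange_big -[RHS](kX1 v0 v1 v2); apply: eq_bigr => x _ /=.
by rewrite -mulr_sumr ch1 mulr1.
Qed.

Lemma outj1_sum v0 v1 : \sum_y outj1 v0 v1 y = marg1 v0 v1.
Proof.
rewrite exchange_big; apply: eq_bigr => v2 _ /=.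
by rewrite -mulr_sumr out_sum1 mulr1.
Qed.

Lemma outj2_sum v0 v2 : \sum_y outj2 v0 v2 y = marg2 v0 v2.
Proof.
rewrite exchange_big; apply: eq_bigr => v1 _ /=.
by rewrite -mulr_sumr out_sum1 mulr1.
Qed.

Hypotheses (k121 : forall v0, \sum_v1 \sum_v2 k12 v0 v1 v2 = 1).

Lemma outj0_sum1 v0 : \sum_y outj0 v0 y = 1.
Proof.
rewrite exchange_big -[RHS](k121 v0); apply: eq_bigr => v1 _ /=; exact: outj1_sum.
Qed.

Lemma outm_sum1 (k0 : V0 -> R) : \sum_v0 k0 v0 = 1 -> \sum_y outm k0 y = 1.
Proof.
move=> k01; rewrite exchange_big -[RHS]k01; apply: eq_bigr => v0 _ /=.
by rewrite -mulr_sumr outj0_sum1 mulr1.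
Qed.

End Output.

Lemma marg1_sum1 v0 : \sum_v1 \sum_v2 k12 v0 v1 v2 = 1 -> \sum_v1 marg1 v0 v1 = 1.
Proof. by []. Qed.

Lemma marg2_sum1 v0 : \sum_v1 \sum_v2 k12 v0 v1 v2 = 1 -> \sum_v2 marg2 v0 v2 = 1.
Proof. by rewrite exchange_big. Qed.

End Kernels.

Section Covering.
Variables (R : realFieldType) (V Z : finType) (kk : V -> R) (jj : V -> Z -> R) (cc : Z -> R).
Variables (L : nat) (beta delta : R).
Hypotheses (kk0 : forall v, 0 <= kk v) (kk1 : \sum_v kk v = 1).
Hypotheses (jj0 : forall v z, 0 <= jj v z) (jj_eq0 : forall v z, kk v = 0 -> jj v z = 0).
Hypotheses (ccE : forall z, cc z = \sum_v jj v z) (cc1 : \sum_z cc z <= 1).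
Hypotheses (L0 : (0 < L)%N) (beta0 : 0 <= beta) (delta0 : 0 < delta).
Hypotheses (beta_le : beta <= delta ^+ 2 * L%:R).

Lemma kk_cond v z : kk v * (jj v z / kk v) = jj v z.
Proof.
have [h|h] := eqVneq (kk v) 0; first by rewrite h mul0r jj_eq0.
by rewrite mulrCA mulfV // mulr1.
Qed.

(** Soft covering for the conditional law [jj v z / kk v]. Letters with [kk v = 0] carry no joint
    mass, so the value of the quotient there is immaterial, and the threshold can be stated without
    division. *)
Lemma covering :
  \sum_(f : L.-tuple V) iid kk f *
     (\sum_z `|L%:R^-1 * \sum_(i < L) (jj (tnth f i) z / kk (tnth f i)) - cc z|)
  <= 2 * (\sum_v \sum_z jj v z * (beta * cc z * kk v < jj v z)%R%:R) + delta.
Proof.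
have c0 v z : 0 <= jj v z / kk v by rewrite divr_ge0.
have cbE z : cc z = \sum_v kk v * (jj v z / kk v).
  by rewrite ccE; apply: eq_bigr => v _; rewrite kk_cond.
apply: le_trans (soft_covering kk0 kk1 c0 cbE cc1 L0 delta0 beta0 beta_le) _.
rewrite lerD2r ler_pM2l //; apply: ler_sum => v _; apply: ler_sum => z _.
rewrite kk_cond; have [h|h] := eqVneq (kk v) 0; first by rewrite jj_eq0 // !mul0r.
by rewrite ltr_pdivlMr // lt_neqAle eq_sym h kk0.
Qed.

End Covering.

Lemma exists_le_sum (R : realFieldType) (I : finType) (P : pred I) :
  [exists i, P i]%:R <= \sum_i (P i)%:R :> R.
Proof.
have [/existsP[k Pk]|_] := boolP [exists i, P i].
  by rewrite (bigD1 k) //= Pk lerDl sumr_ge0 // => *; rewrite ler0n.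
by rewrite sumr_ge0 // => *; rewrite ler0n.
Qed.

(** Change of measure: on the test event [py * kk v0 v] is at most [jj v0 v / g], so a satellite
    drawn independently of [y] passes with probability of order [1 / g]. Keeping [py] as a factor
    avoids dividing by it. *)
Lemma union_bound_conf (R : realFieldType) (V0 V : finType) (k0 : V0 -> R) (kk : V0 -> V -> R)
    (jj : V0 -> V -> R) (L : nat) (g py : R) :
  (forall v0, 0 <= k0 v0) -> (forall v0 v, 0 <= kk v0 v) -> (forall v0, \sum_v kk v0 v = 1) ->
  (forall v0 v, 0 <= jj v0 v) -> (0 < L)%N -> 0 < g -> 0 <= py ->
  py * (\sum_v0 k0 v0 * \sum_(f : L.-tuple V) iid (kk v0) f *
     [exists i, g * py * kk v0 (tnth f i) < jj v0 (tnth f i)]%:R) <=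
  L%:R / g * \sum_v0 k0 v0 * \sum_v jj v0 v.
Proof.
move=> k00 kk0 kk1 jj0 L0 g0 py0.
rewrite !mulr_sumr; apply: ler_sum => v0 _.
rewrite mulrCA [leRHS]mulrCA; apply: ler_wpM2l => //.
pose T v := (g * py * kk v0 v < jj v0 v)%R.
have Ln : L%:R != 0 :> R by rewrite pnatr_eq0 -lt0n.
apply: (@le_trans _ _ (py * \sum_(f : L.-tuple V) iid (kk v0) f *
   (L%:R * (L%:R^-1 * \sum_(i < L) (T (tnth f i))%:R)))).
  apply: ler_wpM2l => //; apply: ler_sum => f _; apply: ler_wpM2l; first exact: iid_ge0.
  rewrite mulVKf //; exact: (exists_le_sum R (fun i => T (tnth f i))).
under eq_bigr do rewrite mulrCA.
rewrite -mulr_sumr (@iid_avg _ _ _ (kk v0) (fun v => (T v)%:R) L0 (kk1 v0)).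
rewrite mulrCA -mulrA; apply: ler_wpM2l; first by rewrite ler0n.
rewrite !mulr_sumr; apply: ler_sum => v _.
rewrite ler_pdivlMl // /T; case: ltP => [h|_] /=; last by rewrite !mulr0.
by rewrite mulr1 mulrA ltW.
Qed.

Section Superposition.
Variables (R : realFieldType) (V0 V1 V2 X : finType).
Variables (k0 : V0 -> R) (k12 : V0 -> V1 -> V2 -> R) (kX : V0 -> V1 -> V2 -> X -> R).
Variables (K L1 L2 : nat).
Hypotheses (k00 : forall v0, 0 <= k0 v0) (k01 : \sum_v0 k0 v0 = 1).
Hypotheses (k120 : forall v0 v1 v2, 0 <= k12 v0 v1 v2).
Hypotheses (k121 : forall v0, \sum_v1 \sum_v2 k12 v0 v1 v2 = 1).
Hypotheses (kX0 : forall v0 v1 v2 x, 0 <= kX v0 v1 v2 x).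
Hypotheses (kX1 : forall v0 v1 v2, \sum_x kX v0 v1 v2 x = 1).
Hypotheses (K0 : (0 < K)%N) (L10 : (0 < L1)%N) (L20 : (0 < L2)%N).

Local Notation k1 := (marg1 k12).
Local Notation k2 := (marg2 k12).

(** Bundling a cloud with its satellites makes the [K] components owned by a message independent and
    identically distributed. *)
Definition codecloud : finType := (V0 * L1.-tuple V1 * L2.-tuple V2)%type.

Definition cluster_law (c : codecloud) : R :=
  k0 c.1.1 * iid (k1 c.1.1) c.1.2 * iid (k2 c.1.1) c.2.

(* Likelihood ratio between the pair law and independent choices of [v1], [v2];
   it replaces the search for a jointly typical pair in Marton coding. *)
Definition lratio v0 v1 v2 : R := k12 v0 v1 v2 / (k1 v0 v1 * k2 v0 v2).

Definition pair_avg (phi : V0 -> V1 -> V2 -> R) (c : codecloud) : R :=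
  L1%:R^-1 * \sum_(i < L1) (L2%:R^-1 * \sum_(j < L2)
     lratio c.1.1 (tnth c.1.2 i) (tnth c.2 j) * phi c.1.1 (tnth c.1.2 i) (tnth c.2 j)).

Definition ideal_enc (s : K.-tuple codecloud) (x : X) : R :=
  K%:R^-1 * \sum_(k < K) pair_avg (fun v0 v1 v2 => kX v0 v1 v2 x) (tnth s k).

(** Where a marginal vanishes the pair law vanishes too, so the ratio undoes the product of
    marginals everywhere. *)
Lemma k12_lratio v0 v1 v2 : k1 v0 v1 * (k2 v0 v2 * lratio v0 v1 v2) = k12 v0 v1 v2.
Proof.
have [h|h1] := eqVneq (k1 v0 v1) 0; first by rewrite h mul0r (marg1_eq0 k120 _ h).
have [h|h2] := eqVneq (k2 v0 v2) 0; first by rewrite h mul0r mulr0 (marg2_eq0 k120 _ h).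
by rewrite /lratio mulrA mulrCA mulfV ?mulr1 // mulf_neq0.
Qed.

Lemma lratio_ge0 v0 v1 v2 : 0 <= lratio v0 v1 v2.
Proof. by rewrite divr_ge0 // mulr_ge0 ?marg1_ge0 ?marg2_ge0. Qed.

Lemma cluster_law_ge0 c : 0 <= cluster_law c.
Proof.
by rewrite !mulr_ge0 // iid_ge0 // => ?; rewrite ?marg1_ge0 ?marg2_ge0.
Qed.

Lemma cluster_sumE (F : V0 -> L1.-tuple V1 -> L2.-tuple V2 -> R) :
  \sum_c cluster_law c * F c.1.1 c.1.2 c.2 =
  \sum_v0 k0 v0 * \sum_f1 iid (k1 v0) f1 * \sum_f2 iid (k2 v0) f2 * F v0 f1 f2.
Proof.
rewrite sum_prod sum_prod; apply: eq_bigr => v0 _.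
rewrite mulr_sumr; apply: eq_bigr => f1 _.
rewrite !mulr_sumr; apply: eq_bigr => f2 _.
by rewrite /cluster_law /= -!mulrA.
Qed.

Lemma cluster_sum1E (F : V0 -> L1.-tuple V1 -> R) :
  \sum_c cluster_law c * F c.1.1 c.1.2 = \sum_v0 k0 v0 * \sum_f1 iid (k1 v0) f1 * F v0 f1.
Proof.
rewrite (cluster_sumE (fun v0 f1 _ => F v0 f1)); apply: eq_bigr => v0 _; congr (_ * _).
apply: eq_bigr => f1 _; rewrite -mulr_suml iid_sum1 ?mul1r //.
exact: marg2_sum1.
Qed.

Lemma cluster_sum2E (F : V0 -> L2.-tuple V2 -> R) :
  \sum_c cluster_law c * F c.1.1 c.2 = \sum_v0 k0 v0 * \sum_f2 iid (k2 v0) f2 * F v0 f2.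
Proof.
rewrite (cluster_sumE (fun v0 _ f2 => F v0 f2)); apply: eq_bigr => v0 _; congr (_ * _).
by rewrite -mulr_suml iid_sum1 ?mul1r // marg1_sum1.
Qed.

Lemma cluster_sum0E (F : V0 -> R) :
  \sum_c cluster_law c * F c.1.1 = \sum_v0 k0 v0 * F v0.
Proof.
rewrite (cluster_sum1E (fun v0 _ => F v0)); apply: eq_bigr => v0 _; congr (_ * _).
by rewrite -mulr_suml iid_sum1 ?mul1r // marg1_sum1.
Qed.

Lemma cluster_law_sum1 : \sum_c cluster_law c = 1.
Proof.
rewrite -[RHS]k01; transitivity (\sum_c cluster_law c * 1).
  by apply: eq_bigr => c _; rewrite mulr1.
by rewrite (cluster_sum0E (fun=> 1)); apply: eq_bigr => c _; rewrite mulr1.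
Qed.

(** Importance sampling: [v1] and [v2] are drawn independently given [v0], and the weight [lratio]
    restores the pair law exactly, whatever [L1] and [L2] are. *)
Lemma pair_avg_mean phi :
  \sum_c cluster_law c * pair_avg phi c =
  \sum_v0 k0 v0 * \sum_v1 \sum_v2 k12 v0 v1 v2 * phi v0 v1 v2.
Proof.
rewrite (cluster_sumE (fun v0 f1 f2 => L1%:R^-1 * \sum_(i < L1) (L2%:R^-1 * \sum_(j < L2)
     lratio v0 (tnth f1 i) (tnth f2 j) * phi v0 (tnth f1 i) (tnth f2 j)))).
apply: eq_bigr => v0 _; congr (_ * _).
pose g v1 := \sum_v2 k2 v0 v2 * (lratio v0 v1 v2 * phi v0 v1 v2).
transitivity (\sum_(f1 : L1.-tuple V1) iid (k1 v0) f1 * (L1%:R^-1 * \sum_(i < L1) g (tnth f1 i))).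
  apply: eq_bigr => f1 _; congr (_ * _).
  under eq_bigr do rewrite mulrCA mulr_sumr.
  rewrite -mulr_sumr exchange_big /=; congr (_ * _); apply: eq_bigr => i _.
  rewrite (iid_avg (fun v2 => lratio v0 (tnth f1 i) v2 * phi v0 (tnth f1 i) v2)) //.
  exact: marg2_sum1.
rewrite (@iid_avg _ _ _ (k1 v0) g L10 (marg1_sum1 (k121 v0))); apply: eq_bigr => v1 _.
rewrite /g mulr_sumr; apply: eq_bigr => v2 _.
by rewrite -[in RHS]k12_lratio -!mulrA.
Qed.

Lemma pair_avg_ge0 phi c : (forall v0 v1 v2, 0 <= phi v0 v1 v2) -> 0 <= pair_avg phi c.
Proof.
move=> phi0; rewrite mulr_ge0 ?invr_ge0 ?ler0n // sumr_ge0 // => i _.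
rewrite mulr_ge0 ?invr_ge0 ?ler0n // sumr_ge0 // => j _.
by rewrite mulr_ge0 ?lratio_ge0.
Qed.

Lemma pair_avg_sum (I : finType) (a : I -> R) (phi : I -> V0 -> V1 -> V2 -> R) c :
  \sum_i a i * pair_avg (phi i) c = pair_avg (fun v0 v1 v2 => \sum_i a i * phi i v0 v1 v2) c.
Proof.
under eq_bigr do rewrite mulrCA mulr_sumr.
rewrite -mulr_sumr exchange_big /=; congr (_ * _); apply: eq_bigr => i _.
under eq_bigr do rewrite mulrCA mulr_sumr.
rewrite -mulr_sumr exchange_big /=; congr (_ * _); apply: eq_bigr => j _.
by rewrite mulr_sumr; apply: eq_bigr => e _; rewrite mulrCA.
Qed.

Lemma ideal_enc_ge0 s x : 0 <= ideal_enc s x.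
Proof.
rewrite mulr_ge0 ?invr_ge0 ?ler0n // sumr_ge0 // => k _.
exact: pair_avg_ge0.
Qed.

Section IdealOutput.
Variables (Y : finType) (ch : X -> Y -> R).
Hypotheses (ch0 : forall x y, 0 <= ch x y) (ch1 : forall x, \sum_y ch x y = 1).

Local Notation o := (out kX ch).

Lemma ideal_out s y :
  \sum_x ideal_enc s x * ch x y =
  K%:R^-1 * \sum_(k < K) pair_avg (fun v0 v1 v2 => o v0 v1 v2 y) (tnth s k).
Proof.
under eq_bigr do rewrite -mulrA mulr_suml.
rewrite -mulr_sumr exchange_big /=; congr (_ * _); apply: eq_bigr => k _.
under eq_bigr do rewrite mulrC.
rewrite pair_avg_sum; congr (_ * _); apply: eq_bigr => i _; congr (_ * _); apply: eq_bigr => j _.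
by congr (_ * _); apply: eq_bigr => x _; rewrite mulrC.
Qed.

Lemma ideal_out_mean y :
  \sum_(s : K.-tuple codecloud) iid cluster_law s * (\sum_x ideal_enc s x * ch x y) =
  outm k12 kX ch k0 y.
Proof.
under eq_bigr do rewrite ideal_out.
by rewrite iid_avg ?cluster_law_sum1 // pair_avg_mean.
Qed.

Variables (tc : codecloud -> Y -> bool) (T : V0 -> V1 -> V2 -> Y -> bool).
Definition tau_of (s : K.-tuple codecloud) (y : Y) : bool := [exists k, tc (tnth s k) y].

Hypothesis T_tc : forall (c : codecloud) y i j,
  T c.1.1 (tnth c.1.2 i) (tnth c.2 j) y -> tc c y.

(** The transmitted pair belongs to the sub-codebook of its message, so the message passes its test
    as soon as that pair passes [T]; [pair_avg_mean] then evaluates the failure of the pair under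
    the true law. *)
Lemma miss_le :
  \sum_(s : K.-tuple codecloud) iid cluster_law s *
     (\sum_y (\sum_x ideal_enc s x * ch x y) * (~~ tau_of s y)%:R) <=
  \sum_v0 k0 v0 * \sum_v1 \sum_v2 \sum_y outj k12 kX ch v0 v1 v2 y * (~~ T v0 v1 v2 y)%:R.
Proof.
apply: (@le_trans _ _ (\sum_(s : K.-tuple codecloud) iid cluster_law s *
  (K%:R^-1 * \sum_(k < K) pair_avg (fun v0 v1 v2 => \sum_y 1 * (o v0 v1 v2 y * (~~ T v0 v1 v2 y)%:R)) (tnth s k)))).
  apply: ler_sum => s _; apply: ler_wpM2l; first exact/iid_ge0/cluster_law_ge0.
  under eq_bigr do rewrite ideal_out -mulrA mulr_suml.
  rewrite -mulr_sumr exchange_big /=; apply: ler_wpM2l; first by rewrite invr_ge0 ler0n.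
  apply: ler_sum => k _; rewrite -pair_avg_sum; apply: ler_sum => y _.
  rewrite mul1r /pair_avg -mulrA; apply: ler_wpM2l; first by rewrite invr_ge0 ler0n.
  rewrite mulr_suml; apply: ler_sum => i _.
  rewrite -mulrA; apply: ler_wpM2l; first by rewrite invr_ge0 ler0n.
  rewrite mulr_suml; apply: ler_sum => j _.
  rewrite -mulrA; apply: ler_wpM2l; first exact: lratio_ge0.
  apply: ler_wpM2l; first exact: out_ge0.
  rewrite ler_nat; set t := T _ _ _ _.
  case tt: t; last by case: (tau_of s y).
  suff -> : tau_of s y by [].
  by apply/existsP; exists k; exact: T_tc tt.
rewrite iid_avg ?cluster_law_sum1 // pair_avg_mean.
apply: ler_sum => v0 _; apply: ler_wpM2l => //; apply: ler_sum => v1 _; apply: ler_sum => v2 _.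
rewrite mulr_sumr; apply: ler_sum => y _.
by rewrite mul1r mulrA.
Qed.

(** On average the ideal output law is exactly [outm], and the tested sub-codebook is independent of
    it; the union over its clouds yields the factor [K]. *)
Lemma conf_le (C : R) :
  (forall y, outm k12 kX ch k0 y * (\sum_c cluster_law c * (tc c y)%:R) <= C * outm k12 kX ch k0 y) ->
  \sum_y (\sum_(s : K.-tuple codecloud) iid cluster_law s * (\sum_x ideal_enc s x * ch x y)) *
     (\sum_(s : K.-tuple codecloud) iid cluster_law s * (tau_of s y)%:R) <= K%:R * C.
Proof.
move=> HC; rewrite -[leRHS]mulr1 -[X in _ <= _ * X](outm_sum1 kX1 ch1 k121 k01) mulr_sumr.
apply: ler_sum => y _; rewrite ideal_out_mean -[leRHS]mulrA.
apply: le_trans (ler_wpM2l (ler0n _ K) (HC y)).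
rewrite mulrCA; apply: ler_wpM2l.
  apply: sumr_ge0 => v0 _; rewrite mulr_ge0 // outj0_ge0 //.
have Kn : K%:R != 0 :> R by rewrite pnatr_eq0 -lt0n.
apply: (@le_trans _ _ (\sum_(s : K.-tuple codecloud) iid cluster_law s *
   (K%:R * (K%:R^-1 * \sum_(k < K) (tc (tnth s k) y)%:R)))).
  apply: ler_sum => s _; apply: ler_wpM2l; first exact/iid_ge0/cluster_law_ge0.
  rewrite mulVKf //; exact: (exists_le_sum R (fun k => tc (tnth s k) y)).
under eq_bigr do rewrite mulrCA.
by rewrite -mulr_sumr (iid_avg (fun c => (tc c y)%:R)) ?cluster_law_sum1.
Qed.

End IdealOutput.
Section Confusion.
Variables (Y : finType) (ch : X -> Y -> R) (g : R).
Hypotheses (ch0 : forall x y, 0 <= ch x y) (g0 : 0 < g).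

Local Notation py := (outm k12 kX ch k0).

(** A threshold [g] on the likelihood ratio p(y | v0, v1) / p(y), cleared of denominators. The other
    satellite family is averaged out, so each receiver looks at its own layer only. *)
Definition test1 v0 v1 y : bool := (g * py y * k1 v0 v1 < outj1 k12 kX ch v0 v1 y)%R.
Definition test2 v0 v2 y : bool := (g * py y * k2 v0 v2 < outj2 k12 kX ch v0 v2 y)%R.
Definition ctest1 (c : codecloud) y : bool := [exists i, test1 c.1.1 (tnth c.1.2 i) y].
Definition ctest2 (c : codecloud) y : bool := [exists i, test2 c.1.1 (tnth c.2 i) y].

Let py0 y : 0 <= py y.
Proof. by apply: sumr_ge0 => v0 _; rewrite mulr_ge0 // outj0_ge0. Qed.

Lemma ctest1_conf y :
  py y * (\sum_c cluster_law c * (ctest1 c y)%:R) <= L1%:R / g * py y.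
Proof.
rewrite (cluster_sum1E (fun v0 f1 => [exists i, test1 v0 (tnth f1 i) y]%:R)).
apply: union_bound_conf => // *; [exact: marg1_ge0|exact: outj1_ge0].
Qed.

Lemma ctest2_conf y :
  py y * (\sum_c cluster_law c * (ctest2 c y)%:R) <= L2%:R / g * py y.
Proof.
rewrite (cluster_sum2E (fun v0 f2 => [exists i, test2 v0 (tnth f2 i) y]%:R)).
have -> : L2%:R / g * py y = L2%:R / g * \sum_v0 k0 v0 * \sum_v2 outj2 k12 kX ch v0 v2 y.
  by congr (_ * _); apply: eq_bigr => v0 _; rewrite outj0E2.
by apply: union_bound_conf => // *;
  [exact: marg2_ge0|exact: marg2_sum1|exact: outj2_ge0].
Qed.

End Confusion.

Section Leakage.
Variables (Z : finType) (ch : X -> Z -> R) (beta0 beta1 beta2 delta : R).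
Hypotheses (ch0 : forall x z, 0 <= ch x z) (ch1 : forall x, \sum_z ch x z = 1).
Hypotheses (b00 : 0 <= beta0) (b10 : 0 <= beta1) (b20 : 0 <= beta2) (delta0 : 0 < delta).
Hypotheses (b0_le : beta0 <= delta ^+ 2 * K%:R) (b1_le : beta1 <= delta ^+ 2 * L1%:R).
Hypotheses (b2_le : beta2 <= delta ^+ 2 * L2%:R).

Local Notation pz := (outm k12 kX ch k0).
Local Notation c0 := (outj0 k12 kX ch).
Local Notation j1 := (outj1 k12 kX ch).
Local Notation j2 := (outj2 k12 kX ch).
Local Notation j12 := (outj k12 kX ch).

Hypothesis markov : forall v0 v1 v2 z, 0 < k0 v0 ->
  j12 v0 v1 v2 z * c0 v0 z = j1 v0 v1 z * j2 v0 v2 z.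

(** [bad1], [bad2] and [bad0] are the masses truncated by the three soft coverings: by satellites of
    either kind given the cloud, and by clouds. *)
Definition bad1 v0 : R := \sum_v1 \sum_z j1 v0 v1 z * (beta1 * c0 v0 z * k1 v0 v1 < j1 v0 v1 z)%R%:R.
Definition bad2 v0 : R := \sum_v2 \sum_z j2 v0 v2 z * (beta2 * c0 v0 z * k2 v0 v2 < j2 v0 v2 z)%R%:R.
Definition bad0 v0 : R := \sum_z c0 v0 z * (beta0 * pz z < c0 v0 z)%R%:R.

(** Normalized to have mean [c0 v0 z]: the empirical means A and B of the overview are [A1] and [A2]
    divided by [c0]. *)
Let A1 v0 (f : L1.-tuple V1) z := L1%:R^-1 * \sum_(i < L1) (j1 v0 (tnth f i) z / k1 v0 (tnth f i)).
Let A2 v0 (f : L2.-tuple V2) z := L2%:R^-1 * \sum_(i < L2) (j2 v0 (tnth f i) z / k2 v0 (tnth f i)).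

Let A2_ge0 v0 f z : 0 <= A2 v0 f z.
Proof.
rewrite mulr_ge0 ?invr_ge0 ?ler0n // sumr_ge0 // => i _.
by rewrite divr_ge0 ?outj2_ge0 ?marg2_ge0.
Qed.

(* The Markov hypothesis makes the weighted double average over the two
   sub-codebooks split into a product of two independent averages. *)
Let pair_avg_split v0 f1 f2 z : 0 < k0 v0 -> c0 v0 z != 0 ->
  pair_avg (fun v0 v1 v2 => out kX ch v0 v1 v2 z) (v0, f1, f2) = A1 v0 f1 z * (A2 v0 f2 z / c0 v0 z).
Proof.
move=> v0p cn.
rewrite /pair_avg /A1 -mulrA; congr (_ * _); rewrite mulr_suml; apply: eq_bigr => i _ /=.
transitivity (L2%:R^-1 * \sum_(j < L2) (j1 v0 (tnth f1 i) z / k1 v0 (tnth f1 i) / c0 v0 z) *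
   (j2 v0 (tnth f2 j) z / k2 v0 (tnth f2 j))).
  congr (_ * _); apply: eq_bigr => j _; rewrite /lratio mulrAC -/(outj _ _ _ _ _ _ _).
  have -> : j12 v0 (tnth f1 i) (tnth f2 j) z =
      j1 v0 (tnth f1 i) z * j2 v0 (tnth f2 j) z / c0 v0 z.
    by rewrite -markov // mulfK.
  by rewrite invfM; ring.
rewrite -mulr_sumr mulrCA -[LHS]mulrA; congr (_ * _); exact: mulrC.
Qed.

(** After splitting, the deviation [A1 * (A2 / c0) - c0] equals [(A1 - c0) * (A2 / c0) + (A2 - c0)].
    The families are independent and [A2 / c0] has mean at most one, so the two covering errors
    simply add. *)
Let cluster_leak v0 : 0 < k0 v0 ->
  \sum_f1 iid (k1 v0) f1 * \sum_f2 iid (k2 v0) f2 *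
    (\sum_z `|pair_avg (fun v0 v1 v2 => out kX ch v0 v1 v2 z) (v0, f1, f2) - c0 v0 z|)
  <= (2 * bad1 v0 + delta) + (2 * bad2 v0 + delta).
Proof.
move=> v0p.
have c00 z : 0 <= c0 v0 z by apply: outj0_ge0.
have c01 : \sum_z c0 v0 z <= 1 by rewrite outj0_sum1.
have cov1 := covering (marg1_ge0 k120 v0) (k121 v0) (outj1_ge0 k120 kX0 ch0 v0)
  (fun v z => @outj1_eq0 _ _ _ _ _ _ kX _ ch k120 v0 v z) (fun=> erefl) c01 L10 b10 delta0 b1_le.
have cov2 := covering (marg2_ge0 k120 v0) (marg2_sum1 (k121 v0)) (outj2_ge0 k120 kX0 ch0 v0)
  (fun v z => @outj2_eq0 _ _ _ _ _ _ kX _ ch k120 v0 v z) (outj0E2 k12 kX ch v0)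
  c01 L20 b20 delta0 b2_le.
apply: le_trans (lerD cov1 cov2).
have A2mean z : \sum_f2 iid (k2 v0) f2 * (A2 v0 f2 z / c0 v0 z) <= 1.
  under eq_bigr do rewrite mulrA.
  rewrite -mulr_suml (@iid_avg _ _ _ (k2 v0) (fun v => j2 v0 v z / k2 v0 v) L20 (marg2_sum1 (k121 v0))).
  have -> : \sum_a k2 v0 a * (j2 v0 a z / k2 v0 a) = c0 v0 z.
    rewrite outj0E2; apply: eq_bigr => a _; apply: kk_cond => v z'; exact: outj2_eq0.
  by have [->|h] := eqVneq (c0 v0 z) 0; rewrite ?mul0r ?ler01 // mulfV.
apply: (@le_trans _ _ (\sum_f1 iid (k1 v0) f1 * \sum_f2 iid (k2 v0) f2 *
    (\sum_z (`|A1 v0 f1 z - c0 v0 z| * (A2 v0 f2 z / c0 v0 z) + `|A2 v0 f2 z - c0 v0 z|)))).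
  apply: ler_sum => f1 _; apply: ler_wpM2l; first exact/iid_ge0/marg1_ge0.
  apply: ler_sum => f2 _; apply: ler_wpM2l; first exact/iid_ge0/marg2_ge0.
  apply: ler_sum => z _; have [h|h] := eqVneq (c0 v0 z) 0.
    have j10 v : j1 v0 v z = 0.
      by apply/eqP; rewrite eq_le outj1_ge0 // andbT -h outj1_le_outj0.
    have -> : pair_avg (fun v0 v1 v2 => out kX ch v0 v1 v2 z) (v0, f1, f2) = 0.
      rewrite /pair_avg big1 ?mulr0 // => i _; rewrite big1 ?mulr0 // => j _ /=.
      rewrite /lratio mulrAC -/(outj _ _ _ _ _ _ _).
      have -> : outj k12 kX ch v0 (tnth f1 i) (tnth f2 j) z = 0.
        have /psumr_eq0P : j1 v0 (tnth f1 i) z = 0 := j10 _.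
        by apply => // *; apply: outj_ge0.
      by rewrite mul0r.
    rewrite h subr0 normr0 invr0 mulr0 mulr0 add0r; exact: normr_ge0.
  rewrite pair_avg_split //.
  rewrite (_ : _ - c0 v0 z = (A1 v0 f1 z - c0 v0 z) * (A2 v0 f2 z / c0 v0 z) + (A2 v0 f2 z - c0 v0 z)).
    by rewrite (le_trans (ler_normD _ _)) // lerD2r normrM [X in _ * X <= _]ger0_norm ?divr_ge0.
  by field.
under eq_bigr => f1 _.
  under eq_bigr do rewrite big_split mulrDr /=.
  rewrite big_split /= mulrDr.
  over.
rewrite big_split /=; apply: lerD; last first.
  by rewrite -mulr_suml iid_sum1 ?mul1r // marg1_sum1.
apply: ler_sum => f1 _; apply: ler_wpM2l; first exact/iid_ge0/marg1_ge0.
under eq_bigr do rewrite mulr_sumr.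
rewrite exchange_big /=; apply: ler_sum => z _.
under eq_bigr do rewrite mulrCA.
by rewrite -mulr_sumr ler_piMr.
Qed.

(** Triangle inequality through the average of [c0] over the clouds: satellites make each cloud look
    like its conditional law at Z, and [K] clouds make these laws average to [pz]. *)
Lemma leak_mean :
  \sum_(s : K.-tuple codecloud) iid cluster_law s *
     (\sum_z `|\sum_x ideal_enc s x * ch x z - pz z|) <=
  (\sum_v0 k0 v0 * (2 * bad1 v0 + delta + (2 * bad2 v0 + delta))) +
  (2 * (\sum_v0 k0 v0 * bad0 v0) + delta).
Proof.
pose q (c : codecloud) z := pair_avg (fun v0 v1 v2 => out kX ch v0 v1 v2 z) c.
apply: (@le_trans _ _ (\sum_(s : K.-tuple codecloud) (iid cluster_law s *
   (K%:R^-1 * \sum_(k < K) \sum_z `|q (tnth s k) z - c0 (tnth s k).1.1 z|) +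
   iid cluster_law s * \sum_z `|K%:R^-1 * (\sum_(k < K) c0 (tnth s k).1.1 z) - pz z|))).
  apply: ler_sum => s _; rewrite -mulrDr; apply: ler_wpM2l; first exact/iid_ge0/cluster_law_ge0.
  rewrite [X in K%:R^-1 * X]exchange_big /= mulr_sumr -big_split /=; apply: ler_sum => z _.
  rewrite ideal_out.
  rewrite (_ : _ - _ = K%:R^-1 * (\sum_(k < K) (q (tnth s k) z - c0 (tnth s k).1.1 z)) +
     (K%:R^-1 * (\sum_(k < K) c0 (tnth s k).1.1 z) - pz z)).
    rewrite (le_trans (ler_normD _ _)) // lerD2r normrM ger0_norm ?invr_ge0 ?ler0n //.
    by rewrite ler_wpM2l ?invr_ge0 ?ler0n // ler_norm_sum.
  by rewrite sumrB; ring.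
rewrite big_split /=; apply: lerD.
  rewrite (@iid_avg _ _ _ _ (fun c => \sum_z `|q c z - c0 c.1.1 z|) K0 cluster_law_sum1).
  rewrite (cluster_sumE (fun v0 f1 f2 => \sum_z `|q (v0, f1, f2) z - c0 v0 z|)).
  apply: ler_sum => v0 _; have [->|h] := eqVneq (k0 v0) 0; first by rewrite !mul0r.
  by apply: ler_wpM2l => //; apply: cluster_leak; rewrite lt_neqAle eq_sym h k00.
have pzE z : pz z = \sum_c cluster_law c * c0 c.1.1 z.
  by rewrite (cluster_sum0E (fun v0 => c0 v0 z)).
have pz1 : \sum_z pz z <= 1 by rewrite outm_sum1.
apply: le_trans (soft_covering cluster_law_ge0 cluster_law_sum1 (fun c z => outj0_ge0 k120 kX0 ch0 c.1.1 z)
  pzE pz1 K0 delta0 b00 b0_le) _.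
rewrite lerD2r ler_pM2l // -(cluster_sum0E bad0); apply: ler_sum => c _.
rewrite /bad0 mulr_sumr; apply: ler_sum => z _.
by rewrite mulrA.
Qed.

End Leakage.
Section OneShot.
Variables (Y1 Y2 Z : finType) (W : X -> Y1 -> Y2 -> Z -> R) (M : nat) (x0 : X).
Variables (beta0 beta1 beta2 delta g1 g2 : R).
Hypotheses (W0 : forall x y1 y2 z, 0 <= W x y1 y2 z).
Hypotheses (W1 : forall x, \sum_y1 \sum_y2 \sum_z W x y1 y2 z = 1).
Hypotheses (M0 : (0 < M)%N) (g10 : 0 < g1) (g20 : 0 < g2).
Hypotheses (b00 : 0 <= beta0) (b10 : 0 <= beta1) (b20 : 0 <= beta2) (delta0 : 0 < delta).
Hypotheses (b0_le : beta0 <= delta ^+ 2 * K%:R) (b1_le : beta1 <= delta ^+ 2 * L1%:R).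
Hypotheses (b2_le : beta2 <= delta ^+ 2 * L2%:R).
Hypothesis markov : forall v0 v1 v2 z, 0 < k0 v0 ->
  outj k12 kX (chZ W) v0 v1 v2 z * outj0 k12 kX (chZ W) v0 z =
  outj1 k12 kX (chZ W) v0 v1 z * outj2 k12 kX (chZ W) v0 v2 z.

Definition miss1 v0 : R := \sum_v1 \sum_y
  outj1 k12 kX (chY1 W) v0 v1 y * (~~ test1 (chY1 W) g1 v0 v1 y)%:R.
Definition miss2 v0 : R := \sum_v2 \sum_y
  outj2 k12 kX (chY2 W) v0 v2 y * (~~ test2 (chY2 W) g2 v0 v2 y)%:R.

Definition one_shot_bound : R :=
  3 * ((\sum_v0 k0 v0 * (2 * bad1 (chZ W) beta1 v0 + delta + (2 * bad2 (chZ W) beta2 v0 + delta))) +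
       (2 * (\sum_v0 k0 v0 * bad0 (chZ W) beta0 v0) + delta)) +
  ((\sum_v0 k0 v0 * miss1 v0 + M%:R * (K%:R * (L1%:R / g1))) +
   (\sum_v0 k0 v0 * miss2 v0 + M%:R * (K%:R * (L2%:R / g2)))).

Lemma one_shot :
  exists (enc : 'I_M -> X -> R) (d1 : Y1 -> option 'I_M) (d2 : Y2 -> option 'I_M),
  [/\ forall m x, 0 <= enc m x, forall m, \sum_x enc m x = 1 &
  code_error W enc d1 d2 + code_leak W (outm k12 kX (chZ W) k0) enc <= one_shot_bound].
Proof.
have Y1sum x : \sum_y chY1 W x y = 1 by exact: W1.
have Y2sum x : \sum_y chY2 W x y = 1 by rewrite -[RHS](W1 x); exact: exchange_big.
have [enc [d1 [d2 [enc0 enc1 E]]]] := @random_coding R X Y1 Y2 Z (K.-tuple codecloud) M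
  (fun s => iid cluster_law s) W ideal_enc (tau_of (ctest1 (chY1 W) g1)) (tau_of (ctest2 (chY2 W) g2))
  (outm k12 kX (chZ W) k0) x0 (fun s => iid_ge0 s cluster_law_ge0) (iid_sum1 _ cluster_law_sum1)
  W0 W1 ideal_enc_ge0 (outm_sum1 kX1 (chZ_sum1 W1) k121 k01) M0.
exists enc, d1, d2; split => //; apply: le_trans E _.
apply: lerD.
  rewrite ler_pM2l //.
  exact: (leak_mean (chZ_ge0 W0) (chZ_sum1 W1) b00 b10 b20 delta0 b0_le b1_le b2_le markov).
apply: lerD; apply: lerD.
- have T_tc (c : codecloud) y i (j : 'I_L2) : test1 (chY1 W) g1 c.1.1 (tnth c.1.2 i) y -> ctest1 (chY1 W) g1 c y.
    by move=> t; apply/existsP; exists i.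
  apply: le_trans (@miss_le _ (chY1 W) (chY1_ge0 W0) _ (fun v0 v1 _ y => test1 (chY1 W) g1 v0 v1 y) T_tc) _.
  apply: ler_sum => v0 _; apply: ler_wpM2l => //; apply: ler_sum => v1 _.
  by rewrite exchange_big; apply: ler_sum => y _ /=; rewrite -mulr_suml.
- apply: ler_wpM2l; first by rewrite ler0n.
  exact: (conf_le (chY1_ge0 W0) Y1sum (ctest1_conf (chY1_ge0 W0) g10)).
- have T_tc (c : codecloud) y (i : 'I_L1) j : test2 (chY2 W) g2 c.1.1 (tnth c.2 j) y -> ctest2 (chY2 W) g2 c y.
    by move=> t; apply/existsP; exists j.
  apply: le_trans (@miss_le _ (chY2 W) (chY2_ge0 W0) _ (fun v0 _ v2 y => test2 (chY2 W) g2 v0 v2 y) T_tc) _.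
  apply: ler_sum => v0 _; apply: ler_wpM2l => //; rewrite exchange_big; apply: ler_sum => v2 _ /=.
  by rewrite exchange_big; apply: ler_sum => y _ /=; rewrite -mulr_suml.
- apply: ler_wpM2l; first by rewrite ler0n.
  exact: (conf_le (chY2_ge0 W0) Y2sum (ctest2_conf (chY2_ge0 W0) g20)).
Qed.

End OneShot.
End Superposition.

(** * Chebyshev bounds on product laws *)

Lemma sum_tuple_pair (R : nmodType) (A B : finType) n (F : n.-tuple A -> n.-tuple B -> R) :
  \sum_a \sum_b F a b =
  \sum_(t : n.-tuple (A * B)) F [tuple (tnth t i).1 | i < n] [tuple (tnth t i).2 | i < n].
Proof.
rewrite pair_bigA /=.
rewrite (reindex (fun t : n.-tuple (A * B) =>
  ([tuple (tnth t i).1 | i < n], [tuple (tnth t i).2 | i < n]))) //=.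
exists (fun p : n.-tuple A * n.-tuple B => [tuple (tnth p.1 i, tnth p.2 i) | i < n]) => [t|[a b]] _ /=.
  by apply: eq_from_tnth => i; rewrite !tnth_mktuple -surjective_pairing.
by congr pair; apply: eq_from_tnth => i; rewrite !tnth_mktuple.
Qed.

Lemma sum_quad (R : nmodType) (A B C D : finType) (F : A -> B -> C -> D -> R) :
  \sum_a \sum_b \sum_c \sum_d F a b c d =
  \sum_(t : A * (B * (C * D))) F t.1 t.2.1 t.2.2.1 t.2.2.2.
Proof.
rewrite sum_prod; apply: eq_bigr => a _; rewrite sum_prod; apply: eq_bigr => b _.
by rewrite sum_prod.
Qed.

Section Chebyshev.
Variables (R : realFieldType) (A B C D : finType).

Lemma sum_quad_second_moment (p f : A -> B -> C -> D -> R) (mu : R) n :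
  \sum_a \sum_b \sum_c \sum_d p a b c d = 1 ->
  \sum_a \sum_b \sum_c \sum_d p a b c d * f a b c d = mu ->
  \sum_(a : n.-tuple A) \sum_(b : n.-tuple B) \sum_(c : n.-tuple C) \sum_(d : n.-tuple D)
    (\prod_(i < n) p (tnth a i) (tnth b i) (tnth c i) (tnth d i)) *
    (\sum_(i < n) f (tnth a i) (tnth b i) (tnth c i) (tnth d i) - n%:R * mu) ^+ 2 =
  n%:R * \sum_a \sum_b \sum_c \sum_d p a b c d * (f a b c d - mu) ^+ 2.
Proof.
move=> p1 fmu.
pose P (t : A * (B * (C * D))) := p t.1 t.2.1 t.2.2.1 t.2.2.2.
pose G (t : A * (B * (C * D))) := f t.1 t.2.1 t.2.2.1 t.2.2.2 - mu.
have P1 : \sum_t P t = 1 by rewrite -sum_quad.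
have PG : \sum_t P t * G t = 0.
  under eq_bigr do rewrite mulrBr.
  by rewrite sumrB -mulr_suml P1 mul1r -(sum_quad (fun a b c d => p a b c d * f a b c d)) fmu subrr.
rewrite [in RHS](sum_quad (fun a b c d => p a b c d * (f a b c d - mu) ^+ 2)).
rewrite -(iid_second_moment n P1 PG).
under eq_bigr => a _.
  under eq_bigr => b _ do rewrite sum_tuple_pair.
  rewrite sum_tuple_pair.
  over.
rewrite sum_tuple_pair; apply: eq_bigr => t _; congr (_ * _ ^+ 2).
  by apply: eq_bigr => i _; rewrite !tnth_mktuple.
rewrite sumrB sumr_const card_ord mulr_natl; congr (_ - _).
by apply: eq_bigr => i _; rewrite !tnth_mktuple.
Qed.

(** The constant depends neither on [n] nor on the event. The event is constrained only on sequences
    of positive probability, where the logarithms used later are meaningful. *)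
Lemma sum_quad_chebyshev (p f : A -> B -> C -> D -> R) (mu eta : R) :
  (forall a b c d, 0 <= p a b c d) ->
  \sum_a \sum_b \sum_c \sum_d p a b c d = 1 ->
  \sum_a \sum_b \sum_c \sum_d p a b c d * f a b c d = mu ->
  0 < eta ->
  exists2 K, 0 <= K & forall n (E : n.-tuple A -> n.-tuple B -> n.-tuple C -> n.-tuple D -> bool),
   (0 < n)%N ->
   (forall a b c d, (forall i, 0 < p (tnth a i) (tnth b i) (tnth c i) (tnth d i)) -> E a b c d ->
     n%:R * eta <= `|\sum_(i < n) f (tnth a i) (tnth b i) (tnth c i) (tnth d i) - n%:R * mu|) ->
   \sum_(a : n.-tuple A) \sum_(b : n.-tuple B) \sum_(c : n.-tuple C) \sum_(d : n.-tuple D)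
    (\prod_(i < n) p (tnth a i) (tnth b i) (tnth c i) (tnth d i)) * (E a b c d)%:R <= K / n%:R.
Proof.
move=> p0 p1 fmu eta0.
pose s2 := \sum_a \sum_b \sum_c \sum_d p a b c d * (f a b c d - mu) ^+ 2.
exists (s2 / eta ^+ 2).
  rewrite divr_ge0 ?sqr_ge0 //.
  by rewrite /s2; do 4! apply: sumr_ge0 => ? _; rewrite mulr_ge0 ?sqr_ge0.
move=> n E n0 HE; have nR : 0 < n%:R :> R by rewrite ltr0n.
have -> : s2 / eta ^+ 2 / n%:R = n%:R * s2 / (n%:R * eta) ^+ 2.
  by field; rewrite !gt_eqF.
rewrite -(sum_quad_second_moment n p1 fmu) mulr_suml; apply: ler_sum => a _.
rewrite mulr_suml; apply: ler_sum => b _; rewrite mulr_suml; apply: ler_sum => c _.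
rewrite mulr_suml; apply: ler_sum => d _.
rewrite -mulrA; set q := \prod_(i < n) _.
have q0 : 0 <= q by apply: prodr_ge0.
have [h|h] := eqVneq q 0; first by rewrite h !mul0r.
apply: ler_wpM2l => //; case: (boolP (E a b c d)) => /= [Ed|_]; last first.
  by rewrite divr_ge0 ?sqr_ge0.
rewrite ler_pdivlMr ?exprn_gt0 ?mulr_gt0 // mul1r.
rewrite -[leRHS]real_normK ?num_real // ler_pXn2r ?nnegrE ?normr_ge0 //; last first.
  by rewrite mulr_ge0 // ltW.
apply: HE => // i; rewrite lt_neqAle p0 andbT eq_sym.
by apply: contra_neq h => h; rewrite /q (bigD1 i) //= h mul0r.
Qed.

End Chebyshev.

(** * Powers of two, base-two logarithms and codebook sizes *)

Section Exp2.
Variable R : realType.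
Implicit Types x y s t : R.

Definition exp2 s : R := 2 `^ s.

Lemma ln2_gt0 : 0 < ln 2 :> R.
Proof. by rewrite ln_gt0 // ltr1n. Qed.

Lemma exp2_gt0 s : 0 < exp2 s.
Proof. by rewrite powR_gt0. Qed.

Lemma exp2D s t : exp2 (s + t) = exp2 s * exp2 t.
Proof. by rewrite /exp2 powRD // pnatr_eq0 implybT. Qed.

Lemma exp2N s : exp2 (- s) = (exp2 s)^-1.
Proof. exact: powRN. Qed.

Lemma exp20 : exp2 0 = 1.
Proof. exact: powRr0. Qed.

Lemma exp2_log2 x : 0 < x -> exp2 (log2 x) = x.
Proof.
move=> x0; apply: ln_inj; rewrite ?posrE ?exp2_gt0 //.
by rewrite ln_powR /log2 divfK // gt_eqF ?ln2_gt0.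
Qed.

Lemma log2_exp2 s : log2 (exp2 s) = s.
Proof. by rewrite /log2 ln_powR mulfK // gt_eqF ?ln2_gt0. Qed.

Lemma exp2_lt s t : (exp2 s < exp2 t) = (s < t).
Proof.
rewrite -[s in RHS]log2_exp2 -[t in RHS]log2_exp2 /log2.
by rewrite ltr_pM2r ?invr_gt0 ?ln2_gt0 // ltr_ln // posrE exp2_gt0.
Qed.

Lemma exp2_le s t : (exp2 s <= exp2 t) = (s <= t).
Proof. by rewrite leNgt exp2_lt -leNgt. Qed.

Lemma exp2_ge1 s : 0 <= s -> 1 <= exp2 s.
Proof. by rewrite -exp20 exp2_le. Qed.

Lemma exp2_sum (I : finType) (f : I -> R) : exp2 (\sum_i f i) = \prod_i exp2 (f i).
Proof. exact: (big_morph _ exp2D exp20). Qed.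

Lemma log2M x y : 0 < x -> 0 < y -> log2 (x * y) = log2 x + log2 y.
Proof. by move=> x0 y0; rewrite /log2 lnM ?posrE // mulrDl. Qed.

Lemma log2_div x y : 0 < x -> 0 < y -> log2 (x / y) = log2 x - log2 y.
Proof. by move=> x0 y0; rewrite /log2 ln_div ?posrE // mulrBl. Qed.

Lemma likelihood_test (I : finType) (x y : I -> R) s :
  (forall i, 0 < x i) -> (forall i, 0 < y i) ->
  (exp2 s * \prod_i y i < \prod_i x i) = (s < \sum_i log2 (x i / y i)).
Proof.
move=> x0 y0; have yp : 0 < \prod_i y i by apply: prodr_gt0 => *.
rewrite -[RHS]exp2_lt exp2_sum [X in _ = (_ < X)](eq_bigr (fun i => x i / y i)); last first.
  by move=> i _; rewrite exp2_log2 // divr_gt0.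
by rewrite big_split /= prodfV ltr_pdivlMr.
Qed.

(** From 1 + x <= e^x. Exponential decay is deliberately weakened to the O(1/n) scale at which
    Chebyshev's inequality already operates. *)
Lemma exp2N_le s : 0 < s -> exp2 (- s) <= (ln 2)^-1 / s.
Proof.
move=> s0; rewrite exp2N -invfM lef_pV2 ?posrE ?exp2_gt0 ?mulr_gt0 ?ln2_gt0 //.
rewrite /exp2 /powR pnatr_eq0 /= mulrC (le_trans _ (expR_ge1Dx _)) // lerDr //.
Qed.

Lemma nmsgE n r : (nmsg n r)%:R = (Num.ceil (exp2 (n%:R * r)))%:~R :> R.
Proof.
rewrite /nmsg -/(exp2 _) natr_absz ger0_norm // ceil_ge0.
by rewrite (lt_trans _ (exp2_gt0 _)) // ltrN10.
Qed.

Lemma nmsg_ge n r : exp2 (n%:R * r) <= (nmsg n r)%:R :> R.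
Proof. by rewrite nmsgE ceil_ge. Qed.

Lemma nmsg_gt0 n (r : R) : (0 < nmsg n r)%N.
Proof. by rewrite -(ltr0n R) (lt_le_trans (exp2_gt0 _) (nmsg_ge _ _)). Qed.

(** A nonnegative rate makes the power at least 1, so rounding up at most doubles it. *)
Lemma nmsg_le n r : 0 <= r -> (nmsg n r)%:R <= 2 * exp2 (n%:R * r) :> R.
Proof.
move=> r0; have e1 : 1 <= exp2 (n%:R * r) by rewrite exp2_ge1 // mulr_ge0.
by have := ceilB1_lt (exp2 (n%:R * r)); rewrite nmsgE intrB; lra.
Qed.

End Exp2.

(** * Relative entropy, likelihood tests and product kernels *)

Section Gibbs.
Variables (R : realType) (A : finType) (p q : A -> R).
Hypotheses (p0 : forall a, 0 <= p a) (q0 : forall a, 0 <= q a).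
Hypotheses (pq : forall a, 0 < p a -> 0 < q a) (qp1 : \sum_a q a <= \sum_a p a).

Lemma ln_le_subr1 (x : R) : 0 < x -> ln x <= x - 1.
Proof. by move=> x0; have := @le_ln1Dx R (x - 1); rewrite (_ : 1 + _ = x); [apply; lra|ring]. Qed.

Lemma ln_eq_subr1 (x : R) : 0 < x -> ln x = x - 1 -> x = 1.
Proof.
move=> x0 lx; apply/eqP; case: (eqVneq (ln x) 0) => [/eqP|h].
  by rewrite ln_eq0.
have := expR_gt1Dx h; rewrite lnK ?posrE // lx; lra.
Qed.

(** The pointwise defect left by ln x <= x - 1 at x = q/p. Nonnegativity of its sum gives the Gibbs
    inequality; vanishing of the sum forces each defect to vanish, which gives the equality case. *)
Let term a : p a * log2 (p a / q a) * ln 2 - (p a - q a) >= 0.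
Proof.
have [h|h] := eqVneq (p a) 0; first by rewrite h !mul0r !sub0r opprK.
have pp : 0 < p a by rewrite lt_neqAle eq_sym h p0.
have qp := pq pp.
rewrite /log2 -mulrA divfK ?gt_eqF ?ln2_gt0 //.
have H := ln_le_subr1 (divr_gt0 qp pp).
rewrite -invf_div lnV ?posrE ?divr_gt0 // invf_div in H.
have : p a * (- ln (p a / q a)) <= p a * (q a / p a - 1) by rewrite ler_wpM2l.
rewrite (_ : p a * (q a / p a - 1) = q a - p a); last by field.
rewrite mulrN; lra.
Qed.

Lemma gibbs_ge0 : 0 <= \sum_a p a * log2 (p a / q a).
Proof.
rewrite -(pmulr_lge0 _ (ln2_gt0 R)) mulr_suml.
have : 0 <= \sum_a (p a * log2 (p a / q a) * ln 2 - (p a - q a)) by apply: sumr_ge0.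
by rewrite !sumrB subr_ge0; apply: le_trans; rewrite subr_ge0.
Qed.

Lemma gibbs_eq : \sum_a p a * log2 (p a / q a) <= 0 -> forall a, p a = q a.
Proof.
move=> le0 a.
have s0 : \sum_a (p a * log2 (p a / q a) * ln 2 - (p a - q a)) = 0.
  apply/eqP; rewrite eq_le sumr_ge0 // andbT !sumrB -mulr_suml.
  rewrite subr_le0 (le_trans (mulr_le0_ge0 le0 (ltW (ln2_gt0 R)))) //.
  by rewrite subr_ge0.
have ta : p a * log2 (p a / q a) * ln 2 - (p a - q a) = 0 by move/psumr_eq0P : s0; apply.
have [h|h] := eqVneq (p a) 0; first by move: ta; rewrite h !mul0r; lra.
have pp : 0 < p a by rewrite lt_neqAle eq_sym h p0.
have qp := pq pp.
have e : ln (q a / p a) = q a / p a - 1.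
  rewrite -invf_div lnV ?posrE ?divr_gt0 // invf_div.
  move: ta; rewrite /log2 -mulrA divfK ?gt_eqF ?ln2_gt0 // => ta.
  apply: (mulfI h); rewrite (_ : p a * (q a / p a - 1) = q a - p a); last by field.
  by rewrite mulrN; lra.
have /eqP := ln_eq_subr1 (divr_gt0 qp pp) e.
by rewrite -(inj_eq (mulIf h)) mul1r divfK // => /eqP.
Qed.

End Gibbs.

Section TestProb.
Variables (R : realType) (A B C D : finType) (p num den : A -> B -> C -> D -> R) (mu eta : R).
Hypotheses (p0 : forall a b c d, 0 <= p a b c d).
Hypotheses (p1 : \sum_a \sum_b \sum_c \sum_d p a b c d = 1).
Hypotheses (num0 : forall a b c d, 0 < p a b c d -> 0 < num a b c d).
Hypotheses (den0 : forall a b c d, 0 < p a b c d -> 0 < den a b c d).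
Hypotheses (muE : \sum_a \sum_b \sum_c \sum_d p a b c d * log2 (num a b c d / den a b c d) = mu).
Hypotheses (eta0 : 0 < eta).

Local Notation "'prod4' F a b c d" :=
  (\prod_i F (tnth a i) (tnth b i) (tnth c i) (tnth d i))
  (at level 10, F, a, b, c, d at level 9).

Lemma test_prob : exists2 K, 0 <= K & forall n, (0 < n)%N ->
  (\sum_(a : n.-tuple A) \sum_(b : n.-tuple B) \sum_(c : n.-tuple C) \sum_(d : n.-tuple D)
     (prod4 p a b c d) * (exp2 (n%:R * (mu + eta)) * (prod4 den a b c d) < prod4 num a b c d)%R%:R
   <= K / n%:R) /\
  (\sum_(a : n.-tuple A) \sum_(b : n.-tuple B) \sum_(c : n.-tuple C) \sum_(d : n.-tuple D)
     (prod4 p a b c d) * (~~ (exp2 (n%:R * (mu - eta)) * (prod4 den a b c d) < prod4 num a b c d)%R)%:R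
   <= K / n%:R).
Proof.
have [K K0 HK] := sum_quad_chebyshev p0 p1 muE eta0.
exists K => // n n0; split; apply: HK => // a b c d pp.
  rewrite likelihood_test => [h|i|i]; [|exact: num0|exact: den0].
  by rewrite (le_trans _ (ler_norm _)) //; lra.
rewrite likelihood_test => [|i|i]; [|exact: num0|exact: den0].
by rewrite -leNgt distrC => h; rewrite (le_trans _ (ler_norm _)) //; lra.
Qed.

End TestProb.

Section ProductKernels.
Variables (R : realFieldType) (n : nat).

(** Memoryless extensions of single-letter kernels. Marginals and channel outputs commute with this
    operation, which reduces the one-shot bound on tuples to single-letter tail events. *)
Definition prod2 (A B : finType) (f : A -> B -> R) (a : n.-tuple A) (b : n.-tuple B) : R :=
  \prod_(i < n) f (tnth a i) (tnth b i).
Definition prod3 (A B C : finType) (f : A -> B -> C -> R) (a : n.-tuple A) (b : n.-tuple B)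
  (c : n.-tuple C) : R := \prod_(i < n) f (tnth a i) (tnth b i) (tnth c i).
Definition prod4 (A B C D : finType) (f : A -> B -> C -> D -> R) (a : n.-tuple A)
  (b : n.-tuple B) (c : n.-tuple C) (d : n.-tuple D) : R :=
  \prod_(i < n) f (tnth a i) (tnth b i) (tnth c i) (tnth d i).

Lemma prod2_sum (A B : finType) (f : A -> B -> R) a :
  \sum_b prod2 f a b = \prod_(i < n) \sum_b f (tnth a i) b.
Proof. exact: (sum_tuple_prod (fun i => f (tnth a i))). Qed.

Lemma prod3_sum (A B C : finType) (f : A -> B -> C -> R) a b :
  \sum_c prod3 f a b c = prod2 (fun a b => \sum_c f a b c) a b.
Proof. exact: (sum_tuple_prod (fun i => f (tnth a i) (tnth b i))). Qed.

Lemma prod4_sum (A B C D : finType) (f : A -> B -> C -> D -> R) a b c :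
  \sum_d prod4 f a b c d = prod3 (fun a b c => \sum_d f a b c d) a b c.
Proof. exact: (sum_tuple_prod (fun i => f (tnth a i) (tnth b i) (tnth c i))). Qed.

Lemma prod4_sum3 (A B C D : finType) (f : A -> B -> C -> D -> R) a b d :
  \sum_c prod4 f a b c d = prod3 (fun a b d => \sum_c f a b c d) a b d.
Proof. exact: (sum_tuple_prod (fun i c => f (tnth a i) (tnth b i) c (tnth d i))). Qed.

Lemma prod4_sum2 (A B C D : finType) (f : A -> B -> C -> D -> R) a c d :
  \sum_b prod4 f a b c d = prod3 (fun a c d => \sum_b f a b c d) a c d.
Proof. exact: (sum_tuple_prod (fun i b => f (tnth a i) b (tnth c i) (tnth d i))). Qed.

Lemma prod3_sum2 (A B C : finType) (f : A -> B -> C -> R) a c :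
  \sum_b prod3 f a b c = prod2 (fun a c => \sum_b f a b c) a c.
Proof. exact: (sum_tuple_prod (fun i b => f (tnth a i) b (tnth c i))). Qed.

Variables (V0 V1 V2 X : finType) (k12 : V0 -> V1 -> V2 -> R) (kX : V0 -> V1 -> V2 -> X -> R).

Lemma marg1_prod v0 v1 : marg1 (prod3 k12) v0 v1 = prod2 (marg1 k12) v0 v1.
Proof. exact: prod3_sum. Qed.

Lemma marg2_prod v0 v2 : marg2 (prod3 k12) v0 v2 = prod2 (marg2 k12) v0 v2.
Proof. exact: prod3_sum2. Qed.

Lemma chY1_prod (Y1 Y2 Z : finType) (W : X -> Y1 -> Y2 -> Z -> R) x y :
  chY1 (prod4 W) x y = prod2 (chY1 W) x y.
Proof. by rewrite /chY1; under eq_bigr do rewrite prod4_sum; exact: prod3_sum. Qed.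

Lemma chY2_prod (Y1 Y2 Z : finType) (W : X -> Y1 -> Y2 -> Z -> R) x y :
  chY2 (prod4 W) x y = prod2 (chY2 W) x y.
Proof. by rewrite /chY2; under eq_bigr do rewrite prod4_sum; exact: prod3_sum2. Qed.

Lemma chZ_prod (Y1 Y2 Z : finType) (W : X -> Y1 -> Y2 -> Z -> R) x y :
  chZ (prod4 W) x y = prod2 (chZ W) x y.
Proof. by rewrite /chZ; under eq_bigr do rewrite prod4_sum3; exact: prod3_sum2. Qed.

Variables (Y : finType) (ch : X -> Y -> R) (chn : n.-tuple X -> n.-tuple Y -> R).
Hypothesis chnE : forall x y, chn x y = prod2 ch x y.

Lemma out_prod v0 v1 v2 y :
  out (prod4 kX) chn v0 v1 v2 y = prod4 (out kX ch) v0 v1 v2 y.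
Proof.
rewrite /out; under eq_bigr do rewrite chnE -big_split /=.
exact: (sum_tuple_prod (fun i x => kX (tnth v0 i) (tnth v1 i) (tnth v2 i) x * ch x (tnth y i))).
Qed.

Lemma outj_prod v0 v1 v2 y :
  outj (prod3 k12) (prod4 kX) chn v0 v1 v2 y = prod4 (outj k12 kX ch) v0 v1 v2 y.
Proof. by rewrite /outj out_prod -big_split. Qed.

Lemma outj1_prod v0 v1 y :
  outj1 (prod3 k12) (prod4 kX) chn v0 v1 y = prod3 (outj1 k12 kX ch) v0 v1 y.
Proof. by rewrite /outj1; under eq_bigr do rewrite outj_prod; exact: prod4_sum3. Qed.

Lemma outj2_prod v0 v2 y :
  outj2 (prod3 k12) (prod4 kX) chn v0 v2 y = prod3 (outj2 k12 kX ch) v0 v2 y.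
Proof. by rewrite /outj2; under eq_bigr do rewrite outj_prod; exact: prod4_sum2. Qed.

Lemma outj0_prod v0 y :
  outj0 (prod3 k12) (prod4 kX) chn v0 y = prod2 (outj0 k12 kX ch) v0 y.
Proof. by rewrite /outj0; under eq_bigr do rewrite outj1_prod; exact: prod3_sum2. Qed.

Lemma outm_prod (Q : finType) (k0 : Q -> V0 -> R) q y :
  outm (prod3 k12) (prod4 kX) chn (prod2 k0 q) y =
  prod2 (fun q => outm k12 kX ch (k0 q)) q y.
Proof.
rewrite /outm; under eq_bigr do rewrite outj0_prod -big_split /=.
exact: (sum_tuple_prod (fun i v0 => k0 (tnth q i) v0 * outj0 k12 kX ch v0 (tnth y i))).
Qed.

End ProductKernels.

(** * Information rates of a superposition layer *)

Section Layer.
Variables (R : realType) (Q V0 V Y : finType).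
Variables (pq : Q -> R) (k0 : Q -> V0 -> R) (kk : V0 -> V -> R) (jj : V0 -> V -> Y -> R).
Variables (c : V0 -> Y -> R) (m : Q -> Y -> R) (eta : R).
Hypotheses (pq0 : forall q, 0 <= pq q) (pq1 : \sum_q pq q = 1).
Hypotheses (k00 : forall q v0, 0 <= k0 q v0) (k01 : forall q, \sum_v0 k0 q v0 = 1).
Hypotheses (kk1 : forall v0, \sum_v kk v0 v = 1).
Hypotheses (jj0 : forall v0 v y, 0 <= jj v0 v y) (jjE : forall v0 v, \sum_y jj v0 v y = kk v0 v).
Hypotheses (cE : forall v0 y, c v0 y = \sum_v jj v0 v y).
Hypotheses (mE : forall q y, m q y = \sum_v0 k0 q v0 * c v0 y).
Hypotheses (eta0 : 0 < eta).

Definition layer_law q v0 v y : R := pq q * k0 q v0 * jj v0 v y.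

Local Notation "'E4' F" := (\sum_q \sum_v0 \sum_v \sum_y layer_law q v0 v y * F q v0 v y)
  (at level 10, F at level 9).

(** Under [layer_law] these are I(V0, V; Y | Q), I(V; Y | V0) and I(V0; Y | Q), written as mean
    log-likelihood ratios; [rate_split] is their chain rule. *)
Definition rate_all : R := E4 (fun q v0 v y => log2 (jj v0 v y / (m q y * kk v0 v))).
Definition rate_sat : R := E4 (fun q v0 v y => log2 (jj v0 v y / (c v0 y * kk v0 v))).
Definition rate_cloud : R := E4 (fun q v0 v y => log2 (c v0 y / m q y)).

Lemma layer_law_ge0 q v0 v y : 0 <= layer_law q v0 v y.
Proof. by rewrite !mulr_ge0. Qed.

Lemma layer_law_sum1 : \sum_q \sum_v0 \sum_v \sum_y layer_law q v0 v y = 1.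
Proof.
rewrite -[RHS]pq1; apply: eq_bigr => q _.
transitivity (\sum_v0 pq q * k0 q v0); last by rewrite -mulr_sumr k01 mulr1.
apply: eq_bigr => v0 _; transitivity (\sum_v pq q * k0 q v0 * kk v0 v).
  by apply: eq_bigr => v _; rewrite -mulr_sumr jjE.
by rewrite -mulr_sumr kk1 mulr1.
Qed.

Let kk0 v0 v : 0 <= kk v0 v.
Proof. by rewrite -jjE sumr_ge0. Qed.

Let c0 v0 y : 0 <= c v0 y.
Proof. by rewrite cE sumr_ge0. Qed.

Let m0 q y : 0 <= m q y.
Proof. by rewrite mE sumr_ge0 // => *; rewrite mulr_ge0. Qed.

Lemma layer_pos q v0 v y : 0 < layer_law q v0 v y ->
  [/\ 0 < jj v0 v y, 0 < kk v0 v, 0 < c v0 y & 0 < m q y].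
Proof.
move=> lp; have h : layer_law q v0 v y != 0 by rewrite gt_eqF.
move: h; rewrite /layer_law !mulf_eq0 !negb_or => /andP[/andP[_ kn] jn].
have jp : 0 < jj v0 v y by rewrite lt_neqAle eq_sym jn jj0.
have kp : 0 < k0 q v0 by rewrite lt_neqAle eq_sym kn k00.
have cp : 0 < c v0 y.
  by rewrite (lt_le_trans jp) // cE (bigD1 v) //= lerDl sumr_ge0.
split => //.
  by rewrite (lt_le_trans jp) // -jjE (bigD1 y) //= lerDl sumr_ge0.
rewrite (lt_le_trans (mulr_gt0 kp cp)) // mE (bigD1 v0) //= lerDl sumr_ge0 // => *.
by rewrite mulr_ge0.
Qed.

Lemma rate_split : rate_all = rate_cloud + rate_sat.
Proof.
rewrite -big_split; apply: eq_bigr => q _; rewrite -big_split; apply: eq_bigr => v0 _.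
rewrite -big_split; apply: eq_bigr => v _; rewrite -big_split; apply: eq_bigr => y _ /=.
have [h|h] := eqVneq (layer_law q v0 v y) 0; first by rewrite h !mul0r addr0.
have /layer_pos[jp kp cp mp] : 0 < layer_law q v0 v y.
  by rewrite lt_neqAle eq_sym h layer_law_ge0.
by rewrite -mulrDr !log2_div ?log2M ?mulr_gt0 //; congr (_ * _); ring.
Qed.

(** Gibbs against the law with [v] and [y] independent given [v0]. The sign of this rate and of the
    cloud rate is what lets [nmsg_le] bound the codebook sizes. *)
Lemma rate_sat_ge0 : 0 <= rate_sat.
Proof.
pose q4 q v0 v y := pq q * k0 q v0 * (c v0 y * kk v0 v).
have q1 : \sum_q \sum_v0 \sum_v \sum_y q4 q v0 v y = 1.
  rewrite -layer_law_sum1; apply: eq_bigr => q _; apply: eq_bigr => v0 _.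
  rewrite /q4 /layer_law.
  under eq_bigr do rewrite -mulr_sumr -mulr_suml.
  under [RHS]eq_bigr do rewrite -mulr_sumr jjE.
  have -> : \sum_y c v0 y = 1.
    under eq_bigr do rewrite cE.
    by rewrite exchange_big /= -[RHS](kk1 v0); apply: eq_bigr => v _.
  by under eq_bigr do rewrite mul1r.
rewrite /rate_sat sum_quad.
have := @gibbs_ge0 R _ (fun t : Q * (V0 * (V * Y)) => layer_law t.1 t.2.1 t.2.2.1 t.2.2.2)
  (fun t => q4 t.1 t.2.1 t.2.2.1 t.2.2.2).
rewrite -!sum_quad q1 layer_law_sum1 lexx => /(_ _ _ _ isT) H.
rewrite (eq_bigr (fun t : Q * (V0 * (V * Y)) => layer_law t.1 t.2.1 t.2.2.1 t.2.2.2 *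
  log2 (layer_law t.1 t.2.1 t.2.2.1 t.2.2.2 / q4 t.1 t.2.1 t.2.2.1 t.2.2.2))).
  apply: H => [t|t|t lp]; rewrite ?layer_law_ge0 ?mulr_ge0 //.
  have [jp kp cp mp] := layer_pos lp.
  by move: lp; rewrite /layer_law pmulr_lgt0 // => pk; apply: mulr_gt0 => //; exact: mulr_gt0.
move=> [q [v0 [v y]]] _ /=.
have [h|h] := eqVneq (layer_law q v0 v y) 0; first by rewrite h !mul0r.
congr (_ * log2 _); rewrite /q4 /layer_law -mulf_div divff ?mul1r //.
by move: h; rewrite /layer_law mulf_eq0 negb_or => /andP[].
Qed.

Lemma rate_cloud_ge0 : 0 <= rate_cloud.
Proof.
(* Gibbs is applied to [p(q) p(v0|q) p(y|v0)] against [p(q) p(v0|q) p(y|q)]. *)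
pose P (t : Q * (V0 * Y)) := pq t.1 * k0 t.1 t.2.1 * c t.2.1 t.2.2.
pose P' (t : Q * (V0 * Y)) := pq t.1 * k0 t.1 t.2.1 * m t.1 t.2.2.
have csum v0 : \sum_y c v0 y = 1.
  under eq_bigr do rewrite cE.
  by rewrite exchange_big /= -[RHS](kk1 v0); apply: eq_bigr => v _.
have msum q : \sum_y m q y = 1.
  under eq_bigr do rewrite mE.
  by rewrite exchange_big /= -[RHS](k01 q); apply: eq_bigr => v0 _; rewrite -mulr_sumr csum mulr1.
have sumPP' : \sum_t P' t <= \sum_t P t.
  apply: eq_imp_ler; rewrite !sum_prod; apply: eq_bigr => q _; rewrite !sum_prod.
  by apply: eq_bigr => v0 _; rewrite /P /P' /= -!mulr_sumr csum msum.
have -> : rate_cloud = \sum_t P t * log2 (P t / P' t).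
  rewrite sum_prod; apply: eq_bigr => q _; rewrite sum_prod; apply: eq_bigr => v0 _.
  rewrite exchange_big; apply: eq_bigr => y _ /=; rewrite -mulr_suml.
  rewrite /layer_law -mulr_sumr -cE /P /P' /=.
  have [h|h] := eqVneq (pq q * k0 q v0) 0; first by rewrite h !mul0r.
  by congr (_ * log2 _); rewrite -mulf_div divff ?mul1r.
apply: gibbs_ge0 => // [[q [v0 y]]|[q [v0 y]]|[q [v0 y]]]; rewrite /P /P' /= ?mulr_ge0 //.
move=> lp; have h : pq q * k0 q v0 * c v0 y != 0 by rewrite gt_eqF.
move: h; rewrite !mulf_eq0 !negb_or => /andP[/andP[pn kn] cn].
have pp : 0 < pq q by rewrite lt_neqAle eq_sym pn pq0.
have kp : 0 < k0 q v0 by rewrite lt_neqAle eq_sym kn k00.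
have cp : 0 < c v0 y by rewrite lt_neqAle eq_sym cn c0.
rewrite !mulr_gt0 // (lt_le_trans (mulr_gt0 kp cp)) // mE (bigD1 v0) //= lerDl sumr_ge0 // => *.
by rewrite mulr_ge0.
Qed.

Lemma layer_sum n (J : n.-tuple V0 -> n.-tuple V -> n.-tuple Y -> R) (T : n.-tuple Q -> n.-tuple V0 -> n.-tuple V -> n.-tuple Y -> bool) :
  (forall v0 v y, J v0 v y = prod3 jj v0 v y) ->
  \sum_q iid pq q * (\sum_v0 prod2 k0 q v0 * \sum_v \sum_y J v0 v y * (T q v0 v y)%:R) =
  \sum_q \sum_v0 \sum_v \sum_y
    (\prod_i layer_law (tnth q i) (tnth v0 i) (tnth v i) (tnth y i)) * (T q v0 v y)%:R.
Proof.
move=> JE; apply: eq_bigr => q _; rewrite mulr_sumr; apply: eq_bigr => v0 _.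
rewrite mulrA mulr_sumr; apply: eq_bigr => v _; rewrite mulr_sumr; apply: eq_bigr => y _.
by rewrite JE mulrA; congr (_ * _); rewrite -!big_split.
Qed.

(** The first tail is a missed detection and is applied to a legitimate receiver; the other two are
    the truncations of soft covering and are applied to Z. *)
Lemma layer_tests : exists2 K, 0 <= K & forall n, (0 < n)%N ->
  [/\ \sum_(q : n.-tuple Q) iid pq q * (\sum_v0 prod2 k0 q v0 * \sum_(v : n.-tuple V) \sum_y prod3 jj v0 v y *
       (~~ (exp2 (n%:R * (rate_all - eta)) * prod2 m q y * prod2 kk v0 v < prod3 jj v0 v y)%R)%:R)
      <= K / n%:R,
     \sum_(q : n.-tuple Q) iid pq q * (\sum_v0 prod2 k0 q v0 * \sum_(v : n.-tuple V) \sum_y prod3 jj v0 v y *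
       (exp2 (n%:R * (rate_sat + eta)) * prod2 c v0 y * prod2 kk v0 v < prod3 jj v0 v y)%R%:R)
      <= K / n%:R &
     \sum_(q : n.-tuple Q) iid pq q * (\sum_v0 prod2 k0 q v0 * \sum_(v : n.-tuple V) \sum_y prod3 jj v0 v y *
       (exp2 (n%:R * (rate_cloud + eta)) * prod2 m q y < prod2 c v0 y)%R%:R)
      <= K / n%:R].
Proof.
have [K1 K10 H1] := @test_prob R Q V0 V Y layer_law (fun _ v0 v y => jj v0 v y)
  (fun q v0 v y => m q y * kk v0 v) rate_all eta layer_law_ge0 layer_law_sum1
  (fun q v0 v y h => let: And4 a _ _ _ := layer_pos h in a)
  (fun q v0 v y h => let: And4 _ a _ b := layer_pos h in mulr_gt0 b a) erefl eta0.
have [K2 K20 H2] := @test_prob R Q V0 V Y layer_law (fun _ v0 v y => jj v0 v y)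
  (fun q v0 v y => c v0 y * kk v0 v) rate_sat eta layer_law_ge0 layer_law_sum1
  (fun q v0 v y h => let: And4 a _ _ _ := layer_pos h in a)
  (fun q v0 v y h => let: And4 _ a b _ := layer_pos h in mulr_gt0 b a) erefl eta0.
have [K3 K30 H3] := @test_prob R Q V0 V Y layer_law (fun _ v0 v y => c v0 y)
  (fun q v0 v y => m q y) rate_cloud eta layer_law_ge0 layer_law_sum1
  (fun q v0 v y h => let: And4 _ _ a _ := layer_pos h in a)
  (fun q v0 v y h => let: And4 _ _ _ a := layer_pos h in a) erefl eta0.
exists (K1 + K2 + K3) => [|n n0]; first by rewrite !addr_ge0.
have le_n x y : x <= y -> x / n%:R <= y / n%:R :> R by move=> xy; rewrite ler_wpM2r // invr_ge0.
split; rewrite layer_sum //.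
- have [_ {}H1] := H1 n n0.
  apply: (le_trans _ (le_n K1 _ _)); last by rewrite -addrA lerDl addr_ge0.
  apply: le_trans H1; apply: eq_imp_ler; do 4! apply: eq_bigr => ? _.
  by rewrite -(mulrA (exp2 _)) /prod2 -big_split.
- have [{}H2 _] := H2 n n0.
  apply: (le_trans _ (le_n K2 _ _)); last by rewrite addrAC lerDr addr_ge0.
  apply: le_trans H2; apply: eq_imp_ler; do 4! apply: eq_bigr => ? _.
  by rewrite -(mulrA (exp2 _)) /prod2 -big_split.
- have [{}H3 _] := H3 n n0.
  apply: (le_trans _ (le_n K3 _ _)); last by rewrite lerDr addr_ge0.
  exact: H3.
Qed.

End Layer.

(** * Codes of length n *)

(** The one-shot bound is linear in the conditional tails, so averaging over time-sharing sequences
    turns them into tails of the full law and leaves the constants unchanged. *)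
Lemma bound_average (R : realFieldType) (Q V : finType) (w : Q -> R) (k : Q -> V -> R)
    (a b c m1 m2 : Q -> V -> R) (d t1 t2 : R) :
  \sum_q w q = 1 -> (forall q, \sum_v k q v = 1) ->
  \sum_q w q * (3 * ((\sum_v k q v * (2 * a q v + d + (2 * b q v + d))) +
                     (2 * (\sum_v k q v * c q v) + d)) +
               ((\sum_v k q v * m1 q v + t1) + (\sum_v k q v * m2 q v + t2))) =
  3 * (2 * (\sum_q w q * (\sum_v k q v * a q v)) + 2 * (\sum_q w q * (\sum_v k q v * b q v)) +
       2 * (\sum_q w q * (\sum_v k q v * c q v)) + 3 * d) +
  (\sum_q w q * (\sum_v k q v * m1 q v) + t1 + (\sum_q w q * (\sum_v k q v * m2 q v) + t2)).
Proof.
move=> w1 k1.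
transitivity (\sum_q (6 * (w q * (\sum_v k q v * a q v)) + 6 * (w q * (\sum_v k q v * b q v)) +
    6 * (w q * (\sum_v k q v * c q v)) + w q * (\sum_v k q v * m1 q v) +
    w q * (\sum_v k q v * m2 q v) + w q * (9 * d + t1 + t2))).
  apply: eq_bigr => q _.
  have -> : \sum_v k q v * (2 * a q v + d + (2 * b q v + d)) =
      2 * (\sum_v k q v * a q v) + 2 * (\sum_v k q v * b q v) + 2 * d.
    have -> : 2 * d = \sum_v k q v * (2 * d) by rewrite -mulr_suml k1 mul1r.
    rewrite (mulr_sumr _ _ _ 2) (mulr_sumr _ _ _ 2) -!big_split /=.
    by apply: eq_bigr => v _; ring.
  by ring.
by rewrite !big_split /= -!mulr_sumr -mulr_suml w1; ring.
Qed.

Section NLetter.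
Variables (R : realType) (Q V0 V1 V2 X Y1 Y2 Z : finType).
Variables (pq : Q -> R) (k0 : Q -> V0 -> R) (k12 : V0 -> V1 -> V2 -> R).
Variables (kX : V0 -> V1 -> V2 -> X -> R) (W : X -> Y1 -> Y2 -> Z -> R).
Hypotheses (pq0 : forall q, 0 <= pq q) (pq1 : \sum_q pq q = 1).
Hypotheses (k00 : forall q v0, 0 <= k0 q v0) (k01 : forall q, \sum_v0 k0 q v0 = 1).
Hypotheses (k120 : forall v0 v1 v2, 0 <= k12 v0 v1 v2).
Hypotheses (k121 : forall v0, \sum_v1 \sum_v2 k12 v0 v1 v2 = 1).
Hypotheses (kX0 : forall v0 v1 v2 x, 0 <= kX v0 v1 v2 x).
Hypotheses (kX1 : forall v0 v1 v2, \sum_x kX v0 v1 v2 x = 1).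
Hypotheses (W0 : forall x y1 y2 z, 0 <= W x y1 y2 z).
Hypotheses (W1 : forall x, \sum_y1 \sum_y2 \sum_z W x y1 y2 z = 1).
Hypothesis markov : forall q v0 v1 v2 z, 0 < pq q -> 0 < k0 q v0 ->
  outj k12 kX (chZ W) v0 v1 v2 z * outj0 k12 kX (chZ W) v0 z =
  outj1 k12 kX (chZ W) v0 v1 z * outj2 k12 kX (chZ W) v0 v2 z.

Definition rate1 (Y : finType) (ch : X -> Y -> R) : R :=
  rate_all pq k0 (marg1 k12) (outj1 k12 kX ch) (fun q => outm k12 kX ch (k0 q)).
Definition rate2 (Y : finType) (ch : X -> Y -> R) : R :=
  rate_all pq k0 (marg2 k12) (outj2 k12 kX ch) (fun q => outm k12 kX ch (k0 q)).

Section Channel.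
Variables (Y : finType) (ch : X -> Y -> R).
Hypotheses (ch0 : forall x y, 0 <= ch x y) (ch1 : forall x, \sum_y ch x y = 1).

Local Notation m := (fun q => outm k12 kX ch (k0 q)).

Definition layer_tests1 (eta : R) (eta0 : 0 < eta) :=
  @layer_tests R Q V0 V1 Y pq k0 (marg1 k12) (outj1 k12 kX ch) (outj0 k12 kX ch) m eta
   pq0 pq1 k00 k01 k121 (outj1_ge0 k120 kX0 ch0) (outj1_sum k12 kX1 ch1)
   (fun _ _ => erefl) (fun _ _ => erefl) eta0.

Definition layer_tests2 (eta : R) (eta0 : 0 < eta) :=
  @layer_tests R Q V0 V2 Y pq k0 (marg2 k12) (outj2 k12 kX ch) (outj0 k12 kX ch) m eta
   pq0 pq1 k00 k01 (fun v0 => marg2_sum1 (k121 v0))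
   (outj2_ge0 k120 kX0 ch0) (outj2_sum k12 kX1 ch1)
   (outj0E2 k12 kX ch) (fun _ _ => erefl) eta0.

(** Summing out either satellite leaves I(V0; Y | Q), so one number of clouds suits both layers. *)
Lemma rate_cloud_sym :
  rate_cloud pq k0 (outj1 k12 kX ch) (outj0 k12 kX ch) m =
  rate_cloud pq k0 (outj2 k12 kX ch) (outj0 k12 kX ch) m.
Proof.
apply: eq_bigr => q _; apply: eq_bigr => v0 _.
rewrite exchange_big [RHS]exchange_big; apply: eq_bigr => y _ /=.
by rewrite -!mulr_suml /layer_law -!mulr_sumr -outj0E2.
Qed.

End Channel.

Let chY1_sum x : \sum_y chY1 W x y = 1. Proof. exact: W1. Qed.
Let chY2_sum x : \sum_y chY2 W x y = 1.
Proof. by rewrite -[RHS](W1 x); exact: exchange_big. Qed.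

Lemma nletter_code (r : R) (x0 : X) : 0 <= r ->
  r < rate1 (chY1 W) - rate1 (chZ W) -> r < rate2 (chY2 W) - rate2 (chZ W) ->
  exists2 C, 0 <= C & forall n, (0 < n)%N ->
  exists pz : n.-tuple Z -> R,
  exists (enc : 'I_(nmsg n r) -> n.-tuple X -> R) (d1 : n.-tuple Y1 -> option 'I_(nmsg n r))
         (d2 : n.-tuple Y2 -> option 'I_(nmsg n r)),
  [/\ forall m x, 0 <= enc m x, forall m, \sum_x enc m x = 1 &
  code_error (prod4 W) enc d1 d2 + code_leak (prod4 W) pz enc <= C / n%:R].
Proof.
move=> r0 r1 r2.
(* The gap is cut into six: two [eta] go to [K], two to the satellites, one to the decoding
   threshold, and the last one remains as decay exponent of the confusion term. *)
pose eta := Num.min (rate1 (chY1 W) - rate1 (chZ W) - r) (rate2 (chY2 W) - rate2 (chZ W) - r) / 6.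
have eta0 : 0 < eta by rewrite divr_gt0 // lt_min !subr_gt0 r1.
have eta1 : 6 * eta <= rate1 (chY1 W) - rate1 (chZ W) - r.
  by rewrite mulrCA divff // mulr1 ge_min lexx.
have eta2 : 6 * eta <= rate2 (chY2 W) - rate2 (chZ W) - r.
  by rewrite mulrCA divff // mulr1 ge_min lexx orbT.
have [Ka Ka0 Ta] := layer_tests1 (chY1_ge0 W0) chY1_sum eta0.
have [Kb Kb0 Tb] := layer_tests2 (chY2_ge0 W0) chY2_sum eta0.
have [Kc Kc0 Tc] := layer_tests1 (chZ_ge0 W0) (chZ_sum1 W1) eta0.
have [Kd Kd0 Td] := layer_tests2 (chZ_ge0 W0) (chZ_sum1 W1) eta0.
pose ka := rate_cloud pq k0 (outj1 k12 kX (chZ W)) (outj0 k12 kX (chZ W))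
  (fun q => outm k12 kX (chZ W) (k0 q)).
pose l1 := rate_sat pq k0 (marg1 k12) (outj1 k12 kX (chZ W)) (outj0 k12 kX (chZ W)).
pose l2 := rate_sat pq k0 (marg2 k12) (outj2 k12 kX (chZ W)) (outj0 k12 kX (chZ W)).
have rZ1 : rate1 (chZ W) = ka + l1.
  apply: rate_split => //; [apply: outj1_ge0|apply: outj1_sum] => //.
    exact: chZ_ge0.
  exact: chZ_sum1.
have rZ2 : rate2 (chZ W) = ka + l2.
  rewrite /ka rate_cloud_sym.
  apply: rate_split => //; [apply: outj2_ge0 => //|apply: outj2_sum => //|exact: outj0E2].
    exact: chZ_ge0.
  exact: chZ_sum1.
have ka0 : 0 <= ka.
  apply: (rate_cloud_ge0 (kk := marg1 k12)) => //.
  - by apply: outj1_ge0 => //; exact: chZ_ge0.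
  - by apply: outj1_sum => //; exact: chZ_sum1.
have l10 : 0 <= l1.
  apply: (rate_sat_ge0 (m := fun q => outm k12 kX (chZ W) (k0 q))) => //.
  - by apply: outj1_ge0 => //; exact: chZ_ge0.
  - by apply: outj1_sum => //; exact: chZ_sum1.
have l20 : 0 <= l2.
  apply: (rate_sat_ge0 (m := fun q => outm k12 kX (chZ W) (k0 q))) => //.
  - by move=> v0; exact: marg2_sum1.
  - by apply: outj2_ge0 => //; exact: chZ_ge0.
  - by apply: outj2_sum => //; exact: chZ_sum1.
  - exact: outj0E2.
(* Constants delivered by [exp2N_le]: [De] for the exponent [eta / 2] of [delta], and [Te] for the
   exponent [eta], with 8 from rounding up three codebook sizes. *)
pose De := (ln 2)^-1 / (eta / 2).
pose Te := 8 * ((ln 2)^-1 / eta).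
have eta_ge0 := ltW eta0.
have il2_ge0 : 0 <= (ln 2)^-1 :> R by rewrite invr_ge0 ltW // ln2_gt0.
clearbody eta.
have De0 : 0 <= De by rewrite !divr_ge0.
have Te0 : 0 <= Te by rewrite mulr_ge0 ?divr_ge0.
exists (3 * (2 * Kc + 2 * Kd + 2 * Kc + 3 * De) + (Ka + Te + (Kb + Te))).
  by move: Ka0 Kb0 Kc0 Kd0 De0 Te0; lra.
move=> n n0; have nR : 0 < n%:R :> R by rewrite ltr0n.
have [{}Ta _ _] := Ta n n0; have [{}Tb _ _] := Tb n n0.
have [_ Tc1 Tc0] := Tc n n0; have [_ {}Td _] := Td n n0.
pose beta0 := exp2 (n%:R * (ka + eta)).
pose beta1 := exp2 (n%:R * (l1 + eta)).
pose beta2 := exp2 (n%:R * (l2 + eta)).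
pose g1 := exp2 (n%:R * (rate1 (chY1 W) - eta)).
pose g2 := exp2 (n%:R * (rate2 (chY2 W) - eta)).
(* Codebook rates exceed the truncation thresholds by [eta], which is exactly what [delta ^+ 2]
   consumes; hence the exponent [eta / 2]. *)
pose delta : R := exp2 (- (n%:R * (eta / 2))).
pose K := nmsg n (ka + 2 * eta).
pose L1 := nmsg n (l1 + 2 * eta).
pose L2 := nmsg n (l2 + 2 * eta).
have beta_le (x : R) : exp2 (n%:R * (x + eta)) <= delta ^+ 2 * (nmsg n (x + 2 * eta))%:R.
  apply: (@le_trans _ _ (delta ^+ 2 * exp2 (n%:R * (x + 2 * eta)))); last first.
    by rewrite ler_wpM2l ?sqr_ge0 ?nmsg_ge.
  by rewrite expr2 -!exp2D exp2_le; apply: eq_imp_ler; field.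
have deltaE : delta <= De / n%:R.
  apply: le_trans (exp2N_le _) _; first by rewrite mulr_gt0 // divr_gt0.
  by apply: eq_imp_ler; rewrite /De; field; rewrite !gt_eqF ?ln2_gt0.
have tE (l i : R) : 0 <= l -> 6 * eta <= i - (ka + l) - r ->
    (nmsg n r)%:R * (K%:R * ((nmsg n (l + 2 * eta))%:R / exp2 (n%:R * (i - eta)))) <= Te / n%:R.
  move=> l0 li; rewrite -exp2N.
  apply: (@le_trans _ _ ((2 * exp2 (n%:R * r)) * ((2 * exp2 (n%:R * (ka + 2 * eta))) *
     ((2 * exp2 (n%:R * (l + 2 * eta))) * exp2 (- (n%:R * (i - eta))))))).
    apply: ler_pM; rewrite ?mulr_ge0 ?(ltW (exp2_gt0 _)) ?nmsg_le //.
    apply: ler_pM; rewrite ?mulr_ge0 ?(ltW (exp2_gt0 _)) ?nmsg_le ?addr_ge0 ?mulr_ge0 ?(ltW eta0) //.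
    apply: ler_pM; rewrite ?mulr_ge0 ?(ltW (exp2_gt0 _)) ?nmsg_le ?addr_ge0 ?mulr_ge0 ?(ltW eta0) //.
  apply: (@le_trans _ _ (8 * exp2 (- (n%:R * eta)))).
    rewrite [leLHS](_ : _ = 8 * (exp2 (n%:R * r) * exp2 (n%:R * (ka + 2 * eta)) *
      exp2 (n%:R * (l + 2 * eta)) * exp2 (- (n%:R * (i - eta))))); last by ring.
    rewrite ler_pM2l // -!exp2D exp2_le -!mulrN -!mulrDr ler_pM2l //; lra.
  rewrite -mulrA ler_pM2l //; apply: le_trans (exp2N_le _) _; first by rewrite mulr_gt0.
  by apply: eq_imp_ler; field; rewrite !gt_eqF ?ln2_gt0.
have prod0 (I : finType) (f : I -> R) : (forall i, 0 <= f i) -> 0 <= \prod_i f i.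
  by move=> f0; apply: prodr_ge0.
have k0n1 (q : n.-tuple Q) : \sum_v0 prod2 k0 q v0 = 1.
  by rewrite prod2_sum big1.
have avg : \sum_(q : n.-tuple Q) iid pq q * one_shot_bound (prod2 k0 q) (prod3 k12) (prod4 kX) K L1 L2 (prod4 W)
    (nmsg n r) beta0 beta1 beta2 delta g1 g2 <=
    (3 * (2 * Kc + 2 * Kd + 2 * Kc + 3 * De) + (Ka + Te + (Kb + Te))) / n%:R.
  have avgE := bound_average
    (fun _ v0 => bad1 (prod3 k12) (prod4 kX) (chZ (prod4 W)) beta1 v0)
    (fun _ v0 => bad2 (prod3 k12) (prod4 kX) (chZ (prod4 W)) beta2 v0)
    (fun q v0 => bad0 (prod2 k0 q) (prod3 k12) (prod4 kX) (chZ (prod4 W)) beta0 v0)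
    (fun q v0 => miss1 (prod2 k0 q) (prod3 k12) (prod4 kX) (prod4 W) g1 v0)
    (fun q v0 => miss2 (prod2 k0 q) (prod3 k12) (prod4 kX) (prod4 W) g2 v0)
    delta ((nmsg n r)%:R * (K%:R * (L1%:R / g1))) ((nmsg n r)%:R * (K%:R * (L2%:R / g2)))
    (iid_sum1 n pq1) k0n1.
  rewrite /one_shot_bound avgE.
  rewrite [leRHS](_ : _ = 3 * (2 * (Kc / n%:R) + 2 * (Kd / n%:R) + 2 * (Kc / n%:R) + 3 * (De / n%:R)) +
    (Ka / n%:R + Te / n%:R + (Kb / n%:R + Te / n%:R))); last by ring.
  have jZ1E := outj1_prod k12 kX (@chZ_prod R n X Y1 Y2 Z W).
  have jZ2E := outj2_prod k12 kX (@chZ_prod R n X Y1 Y2 Z W).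
  have jZ0E := outj0_prod k12 kX (@chZ_prod R n X Y1 Y2 Z W).
  have pZE := outm_prod k12 kX (@chZ_prod R n X Y1 Y2 Z W) k0.
  have jY1E := outj1_prod k12 kX (@chY1_prod R n X Y1 Y2 Z W).
  have pY1E := outm_prod k12 kX (@chY1_prod R n X Y1 Y2 Z W) k0.
  have jY2E := outj2_prod k12 kX (@chY2_prod R n X Y1 Y2 Z W).
  have pY2E := outm_prod k12 kX (@chY2_prod R n X Y1 Y2 Z W) k0.
  apply: lerD.
    rewrite ler_pM2l //; apply: lerD; [apply: lerD; [apply: lerD|]|]; rewrite ler_pM2l //.
    - apply: le_trans Tc1; apply: eq_imp_ler; apply: eq_bigr => q _; congr (_ * _).
      apply: eq_bigr => v0 _; congr (_ * _); apply: eq_bigr => v1 _; apply: eq_bigr => z _.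
      by rewrite jZ1E jZ0E marg1_prod.
    - apply: le_trans Td; apply: eq_imp_ler; apply: eq_bigr => q _; congr (_ * _).
      apply: eq_bigr => v0 _; congr (_ * _); apply: eq_bigr => v1 _; apply: eq_bigr => z _.
      by rewrite jZ2E jZ0E marg2_prod.
    - apply: le_trans Tc0; apply: eq_imp_ler; apply: eq_bigr => q _; congr (_ * _).
      apply: eq_bigr => v0 _; congr (_ * _); rewrite exchange_big; apply: eq_bigr => z _ /=.
      by rewrite -mulr_suml jZ0E pZE -prod3_sum2.
  apply: lerD; apply: lerD.
  - apply: le_trans Ta; apply: eq_imp_ler; apply: eq_bigr => q _; congr (_ * _).
    apply: eq_bigr => v0 _; congr (_ * _); apply: eq_bigr => v1 _; apply: eq_bigr => z _.
    by rewrite /test1 jY1E pY1E marg1_prod.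
  - by apply: tE => //; rewrite -rZ1.
  - apply: le_trans Tb; apply: eq_imp_ler; apply: eq_bigr => q _; congr (_ * _).
    apply: eq_bigr => v0 _; congr (_ * _); apply: eq_bigr => v1 _; apply: eq_bigr => z _.
    by rewrite /test2 jY2E pY2E marg2_prod.
  - by apply: tE => //; rewrite -rZ2.
(* The sequence [q] has positive probability, so each of its letters does, and the single-letter
   Markov identity can be multiplied along the block. *)
have [q qp HB] := weighted_le_witness (fun q => iid_ge0 q pq0) (iid_sum1 n pq1) avg.
exists (outm (prod3 k12) (prod4 kX) (chZ (prod4 W)) (prod2 k0 q)).
have markov_n v0 v1 v2 z : 0 < prod2 k0 q v0 ->
  outj (prod3 k12) (prod4 kX) (chZ (prod4 W)) v0 v1 v2 z * outj0 (prod3 k12) (prod4 kX) (chZ (prod4 W)) v0 z =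
  outj1 (prod3 k12) (prod4 kX) (chZ (prod4 W)) v0 v1 z * outj2 (prod3 k12) (prod4 kX) (chZ (prod4 W)) v0 v2 z.
  move=> kp; rewrite (outj_prod k12 kX (@chZ_prod R n X Y1 Y2 Z W)).
  rewrite (outj0_prod k12 kX (@chZ_prod R n X Y1 Y2 Z W)).
  rewrite (outj1_prod k12 kX (@chZ_prod R n X Y1 Y2 Z W)).
  rewrite (outj2_prod k12 kX (@chZ_prod R n X Y1 Y2 Z W)).
  rewrite -!big_split; apply: eq_bigr => i _ /=; apply: (@markov (tnth q i)).
    rewrite lt_neqAle pq0 andbT eq_sym; apply: contraTneq qp => h.
    by rewrite /iid (bigD1 i) //= h mul0r ltxx.
  rewrite lt_neqAle k00 andbT eq_sym; apply: contraTneq kp => h.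
  by rewrite /prod2 (bigD1 i) //= h mul0r ltxx.
have [|||||||enc [d1 [d2 [e0 e1 e2]]]] := @one_shot R _ _ _ _ (prod2 k0 q) (prod3 k12) (prod4 kX) K L1 L2
  _ (k0n1 q) _ _ _ _ (nmsg_gt0 _ _) (nmsg_gt0 _ _) (nmsg_gt0 _ _) _ _ _ (prod4 W) (nmsg n r)
  [tuple x0 | i < n] beta0 beta1 beta2 delta g1 g2 _ _ (nmsg_gt0 _ _) (exp2_gt0 _) (exp2_gt0 _)
  (ltW (exp2_gt0 _)) (ltW (exp2_gt0 _)) (ltW (exp2_gt0 _)) (exp2_gt0 _)
  (beta_le _) (beta_le _) (beta_le _) markov_n.
- by move=> v0; exact: prod0.
- by move=> *; exact: prod0.
- move=> v0; under eq_bigr do rewrite prod3_sum.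
  by rewrite prod2_sum big1.
- by move=> *; exact: prod0.
- by move=> *; rewrite prod4_sum /prod3 big1.
- by move=> *; exact: prod0.
- move=> x; under eq_bigr do [under eq_bigr do rewrite prod4_sum; rewrite prod3_sum].
  by rewrite prod2_sum big1.
exists enc, d1, d2; split => //; exact: le_trans e2 HB.
Qed.

End NLetter.

(** * Equivocation and achievability *)

Section Entropy.
Variable R : realType.

Lemma entropyE (A : finType) (p : A -> R) : entropy p = - \sum_a p a * log2 (p a).
Proof.
by congr (- _); apply: eq_bigr => a _; case: eqP => [->|//]; rewrite mul0r.
Qed.

Lemma pushf_expect (T A : finType) (P : T -> R) (f : T -> A) (F : A -> R) :
  \sum_a pushf P f a * F a = \sum_t P t * F (f t).
Proof.
rewrite [RHS](partition_big f xpredT) //=; apply: eq_bigr => a _.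
by rewrite mulr_suml; apply: eq_bigr => t /eqP ->.
Qed.

Lemma EntE (T A : finType) (P : T -> R) (f : T -> A) :
  Ent P f = - \sum_t P t * log2 (pushf P f (f t)).
Proof. by rewrite /Ent entropyE (pushf_expect P f (fun a => log2 (pushf P f a))). Qed.

Lemma pushf_comp (T A B : finType) (P : T -> R) (f : T -> A) (h : A -> B) b :
  pushf P (fun t => h (f t)) b = pushf (pushf P f) h b.
Proof.
rewrite /pushf (partition_big f (fun a => h a == b)) //=; apply: eq_bigr => a hb.
by apply: eq_bigl => t; case: (f t =P a) => [->|]; rewrite ?andbF // hb.
Qed.

Lemma Ent_comp (T A B : finType) (P : T -> R) (f : T -> A) (h : A -> B) :
  Ent P (fun t => h (f t)) = Ent (pushf P f) h.
Proof.
by rewrite /Ent !entropyE; congr (- _); apply: eq_bigr => b _; rewrite pushf_comp.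
Qed.

(* [t ln t <= (1 + ln M) (t - 1)] on [1 <= t <= M], applied to the ratio of
   [J] to the law under which the message is uniform and independent of [z]. *)
Lemma equivocation_ge (M : nat) (Z : finType) (J : 'I_M -> Z -> R) (pz : Z -> R) :
  (0 < M)%N -> (forall m z, 0 <= J m z) -> \sum_m \sum_z J m z = 1 ->
  log2 M%:R - (1 + ln M%:R) / ln 2 * (2 * \sum_m \sum_z `|J m z - M%:R^-1 * pz z|) <=
  - (\sum_m \sum_z J m z * log2 (J m z)) + \sum_z (\sum_m J m z) * log2 (\sum_m J m z).
Proof.
move=> M0 J0 J1.
have MR : 0 < M%:R :> R by rewrite ltr0n.
have lM : 0 <= ln M%:R :> R by rewrite ln_ge0 // ler1n.
pose P z := \sum_m J m z.
have JP m z : J m z <= P z by rewrite /P (bigD1 m) //= lerDl sumr_ge0.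
have P0 z : 0 <= P z by apply: sumr_ge0.
pose U m z := J m z * log2 (M%:R * J m z / P z).
have split_log : - (\sum_m \sum_z J m z * log2 (J m z)) + \sum_z P z * log2 (P z) =
    log2 M%:R - \sum_m \sum_z U m z.
  have -> : \sum_z P z * log2 (P z) = \sum_m \sum_z J m z * log2 (P z).
    by rewrite [RHS]exchange_big; apply: eq_bigr => z _; rewrite mulr_suml.
  have -> : log2 M%:R = \sum_m \sum_z J m z * log2 M%:R.
    by under eq_bigr do rewrite -mulr_suml; rewrite -mulr_suml J1 mul1r.
  rewrite -!sumrN -!big_split /=; apply: eq_bigr => m _.
  rewrite -!sumrN -!big_split /=; apply: eq_bigr => z _.
  have [h|h] := eqVneq (J m z) 0; first by rewrite /U h !mul0r oppr0.
  have Jp : 0 < J m z by rewrite lt_neqAle eq_sym h J0.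
  have Pp : 0 < P z := lt_le_trans Jp (JP m z).
  by rewrite /U log2_div ?log2M ?mulr_gt0 //; ring.
rewrite split_log lerD2l lerN2.
have U_le m z : U m z <= (1 + ln M%:R) / ln 2 * `|J m z - M%:R^-1 * P z|.
  have [h|h] := eqVneq (J m z) 0.
    by rewrite /U h mul0r mulr_ge0 // divr_ge0 ?addr_ge0 // ltW ?ln2_gt0.
  have Jp : 0 < J m z by rewrite lt_neqAle eq_sym h J0.
  have Pp : 0 < P z := lt_le_trans Jp (JP m z).
  rewrite /U /log2; set t := M%:R * J m z / P z.
  have tp : 0 < t by rewrite divr_gt0 // mulr_gt0.
  have JE : J m z = t * P z / M%:R by rewrite /t; field; rewrite !gt_eqF.
  have tM : t <= M%:R by rewrite ler_pdivrMr // ler_pM2l.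
  rewrite mulrA [leRHS]mulrAC ler_pM2r ?invr_gt0 ?ln2_gt0 //.
  (* For [t <= 1] the logarithm is nonpositive and the term costs nothing; only ratios above 1 are
     compared with the L1 distance. *)
  have [t1|t1] := leP t 1.
    rewrite (@le_trans _ _ 0) ?mulr_ge0 ?addr_ge0 //.
    by rewrite mulr_ge0_le0 // -ln1 ler_ln ?posrE.
  apply: (@le_trans _ _ ((1 + ln M%:R) * (J m z - M%:R^-1 * P z))); last first.
    by rewrite ler_wpM2l ?addr_ge0 ?ler_norm.
  rewrite JE (_ : t * P z / M%:R * ln t = (P z / M%:R) * (t * ln t)); last by ring.
  rewrite (_ : (1 + ln M%:R) * _ = (P z / M%:R) * ((t - 1) * (1 + ln M%:R))); last by ring.
  apply: ler_wpM2l; first by rewrite divr_ge0 // ltW.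
  have l1 := ln_le_subr1 tp.
  have l2 : ln t <= ln M%:R by rewrite ler_ln ?posrE.
  have l3 : (t - 1) * ln t <= (t - 1) * ln M%:R by rewrite ler_wpM2l // subr_ge0 ltW.
  rewrite (_ : t * ln t = ln t + (t - 1) * ln t); last by ring.
  by rewrite mulrDr mulr1 lerD.
apply: (@le_trans _ _ ((1 + ln M%:R) / ln 2 * \sum_m \sum_z `|J m z - M%:R^-1 * P z|)).
  rewrite mulr_sumr; apply: ler_sum => m _; rewrite mulr_sumr; apply: ler_sum => z _.
  exact: U_le.
rewrite ler_wpM2l ?divr_ge0 ?addr_ge0 ?(ltW (ln2_gt0 _)) //.
(* Replacing the reference law [pz] by the true output law [P] at most doubles the distance, since
   summing over messages does not increase it. *)
set D := \sum_m \sum_z `|J m z - M%:R^-1 * pz z|.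
have -> : 2 * D = D + \sum_(m < M) M%:R^-1 * D.
  by rewrite sumr_const card_ord -[_ *+ M]mulr_natl mulVKf ?gt_eqF //; ring.
rewrite -big_split; apply: ler_sum => m _ /=.
apply: (@le_trans _ _ (\sum_z (`|J m z - M%:R^-1 * pz z| + M%:R^-1 * `|pz z - P z|))).
  apply: ler_sum => z _.
  rewrite (_ : J m z - M%:R^-1 * P z = J m z - M%:R^-1 * pz z + M%:R^-1 * (pz z - P z)); last by ring.
  by rewrite (le_trans (ler_normD _ _)) // normrM [`|M%:R^-1|]ger0_norm // invr_ge0 ltW.
rewrite big_split lerD2l /= -mulr_sumr; apply: ler_wpM2l; first by rewrite invr_ge0 ltW.
rewrite /D exchange_big; apply: ler_sum => z _ /=.
have -> : pz z - P z = - \sum_m (J m z - M%:R^-1 * pz z).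
  rewrite sumrB sumr_const card_ord -[_ *+ M]mulr_natl mulVKf ?gt_eqF //.
  by rewrite opprB.
by rewrite normrN ler_norm_sum.
Qed.

End Entropy.

Section CodeRecord.
Variables (R : realType) (X Y1 Y2 Z : finType) (W : X -> Y1 -> Y2 -> Z -> R) (M n : nat).
Variable c : Defs.code R X Y1 Y2 M n.

Lemma code_PeE : code_Pe W c = code_error (prod4 W) (enc c) (dec1 c) (dec2 c).
Proof.
rewrite /code_Pe big_mkcond /= !sum_prod /code_error mulr_sumr; apply: eq_bigr => m _.
rewrite mulr_sumr; apply: eq_bigr => x _; rewrite !mulr_sumr; apply: eq_bigr => y1 _.
rewrite !mulr_sumr; apply: eq_bigr => y2 _; rewrite !mulr_sumr; apply: eq_bigr => z _ /=.
by case: ifP => _; rewrite ?mulr1 ?mulr0 // !mulrA.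
Qed.

Hypotheses (W0 : forall x y1 y2 z, 0 <= W x y1 y2 z).
Hypotheses (W1 : forall x, \sum_y1 \sum_y2 \sum_z W x y1 y2 z = 1).
Hypothesis M0 : (0 < M)%N.

Lemma prod4_ge0 (x : n.-tuple X) y1 y2 z : 0 <= prod4 W x y1 y2 z.
Proof. exact: prodr_ge0. Qed.

Lemma prod4_sum1 (x : n.-tuple X) : \sum_y1 \sum_y2 \sum_z prod4 W x y1 y2 z = 1.
Proof.
under eq_bigr do [under eq_bigr do rewrite prod4_sum; rewrite prod3_sum].
by rewrite prod2_sum big1.
Qed.

Lemma code_Pe_ge0 : 0 <= code_Pe W c.
Proof.
rewrite code_PeE mulr_ge0 ?invr_ge0 ?ler0n //; do 2! (apply: sumr_ge0 => ? _).
rewrite mulr_ge0 ?enc_ge0 //; do 3! (apply: sumr_ge0 => ? _).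
by rewrite mulr_ge0 ?prod4_ge0 ?ler0n.
Qed.

Lemma code_equiv_ge pz : log2 M%:R - (1 + ln M%:R) / ln 2 * (2 * code_leak (prod4 W) pz (enc c)) <=
  code_equiv W c.
Proof.
pose J m z := M%:R^-1 * \sum_x enc c m x * chZ (prod4 W) x z.
have MR : 0 < M%:R :> R by rewrite ltr0n.
have J0 m z : 0 <= J m z.
  rewrite mulr_ge0 ?invr_ge0 ?ler0n // sumr_ge0 // => x _.
  by rewrite mulr_ge0 ?enc_ge0 ?chZ_ge0 // => *; apply: prod4_ge0.
have J1 : \sum_m \sum_z J m z = 1.
  transitivity (\sum_(m < M) (M%:R^-1 : R)); last first.
    by rewrite sumr_const card_ord -[_ *+ M]mulr_natl mulfV // gt_eqF.
  apply: eq_bigr => m _; rewrite -mulr_sumr exchange_big /=.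
  rewrite (eq_bigr (fun x => enc c m x)) ?enc_sum1 ?mulr1 // => x _.
  by rewrite -mulr_sumr (chZ_sum1 prod4_sum1) mulr1.
have pushJ m z : pushf (code_joint W c) (fun t => (t.1.1.1.1, t.2)) (m, z) = J m z.
  rewrite /pushf big_mkcond /= !sum_prod (bigD1 m) //= [X in _ + X]big1 ?addr0; last first.
    move=> m' /negbTE mm'; do 4! (apply: big1 => ? _).
    by rewrite xpair_eqE mm'.
  rewrite /J mulr_sumr; apply: eq_bigr => x _; rewrite /chZ !mulr_sumr; apply: eq_bigr => y1 _.
  rewrite !mulr_sumr; apply: eq_bigr => y2 _; rewrite (bigD1 z) //= eqxx [X in _ + X]big1 ?addr0.
    by rewrite mulrA.
  by move=> z' /negbTE zz'; rewrite xpair_eqE zz' andbF.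
have pushZ z : pushf (code_joint W c) (fun t => t.2) z = \sum_m J m z.
  rewrite (pushf_comp _ (fun t : code_space X Y1 Y2 Z M n => (t.1.1.1.1, t.2)) snd) /pushf.
  rewrite big_mkcond /= sum_prod; apply: eq_bigr => m _.
  rewrite (bigD1 z) //= eqxx [X in _ + X]big1 ?addr0.
    exact: pushJ.
  by move=> z' /negbTE ->.
have -> : code_leak (prod4 W) pz (enc c) = \sum_m \sum_z `|J m z - M%:R^-1 * pz z|.
  rewrite /code_leak mulr_sumr; apply: eq_bigr => m _; rewrite mulr_sumr; apply: eq_bigr => z _.
  by rewrite -mulrBr normrM [`|M%:R^-1|]ger0_norm // invr_ge0 ltW.
apply: le_trans (equivocation_ge pz M0 J0 J1) _.
rewrite /code_equiv /condEnt /Ent !entropyE opprK sum_prod; apply: eq_imp_ler; congr (- _ + _).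
  by apply: eq_bigr => m _; apply: eq_bigr => z _; rewrite pushJ.
by apply: eq_bigr => z _; rewrite pushZ.
Qed.

End CodeRecord.

Section Achievability.
Variables (R : realType) (X Y1 Y2 Z : finType) (W : X -> Y1 -> Y2 -> Z -> R) (x0 : X).
Hypotheses (W0 : forall x y1 y2 z, 0 <= W x y1 y2 z).
Hypotheses (W1 : forall x, \sum_y1 \sum_y2 \sum_z W x y1 y2 z = 1).

Lemma limn_einf_ge (u : nat -> R) (r C : R) : 0 <= C ->
  (forall n, (0 < n)%N -> r - C / n%:R <= u n) -> (r%:E <= limn_einf (fun n => (u n)%:E))%E.
Proof.
move=> C0 ru; rewrite limn_einf_lim; apply/lee_addgt0Pr => e e0.
rewrite -leeBlDr //; apply: lime_ge; first exact: is_cvg_einfs.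
near=> k; apply: le_ereal_inf_tmp => _ [n /= kn <-].
have k0 : (0 < k)%N by near: k; exact: nbhs_infty_gt.
have kC : C / e <= k%:R by near: k; exact: nbhs_infty_ger.
have n0 : (0 < n)%N by exact: leq_trans kn.
rewrite -EFinB lee_fin (le_trans _ (ru n n0)) // lerD2l lerN2.
rewrite ler_pdivrMr ?ltr0n // mulrC -ler_pdivrMr // (le_trans kC) // ler_nat //.
Unshelve. all: by end_near. Qed.

(** An L1 leakage of O(1/n) loses O(1/n) times [1 + ln M], that is a bounded number of bits, which
    disappears after division by the block length. *)
Lemma achievable_of_codes (r C : R) : 0 <= r -> 0 <= C ->
  (forall n, (0 < n)%N -> exists pz : n.-tuple Z -> R,
   exists (enc : 'I_(nmsg n r) -> n.-tuple X -> R) (d1 : n.-tuple Y1 -> option 'I_(nmsg n r))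
          (d2 : n.-tuple Y2 -> option 'I_(nmsg n r)),
   [/\ forall m x, 0 <= enc m x, forall m, \sum_x enc m x = 1 &
    code_error (prod4 W) enc d1 d2 + code_leak (prod4 W) pz enc <= C / n%:R]) ->
  achievable W r.
Proof.
move=> r0 C0 H.
have codes n : exists c : Defs.code R X Y1 Y2 (nmsg n r) n, (0 < n)%N ->
    code_Pe W c <= C / n%:R /\ exists pz, code_leak (prod4 W) pz (enc c) <= C / n%:R.
  case: n => [|n].
    (* Block length zero is invisible to both limits; any code will do, and the unique empty tuple
       receives mass one. *)
    pose e (m : 'I_(nmsg 0 r)) (x : 0.-tuple X) : R := 1.
    have e1 m : \sum_x e m x = 1 by rewrite sumr_const card_tuple expn0.
    by exists (Code (fun m x => ler01) e1 (fun=> None) (fun=> None)).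
  have [pz [en [d1 [d2 [e0 e1 le]]]]] := H n.+1 isT.
  exists (Code e0 e1 d1 d2) => _.
  have leak0 : 0 <= code_leak (prod4 W) pz en.
    by rewrite mulr_ge0 ?invr_ge0 ?ler0n // sumr_ge0 // => *; rewrite sumr_ge0.
  have Pe0 := code_Pe_ge0 (Code e0 e1 d1 d2) W0.
  rewrite code_PeE /= in Pe0 *.
  by split; [|exists pz]; apply: le_trans le; rewrite ?lerDl ?lerDr.
pose c n := sval (cid (codes n)).
have Hc n : (0 < n)%N -> code_Pe W (c n) <= C / n%:R /\
    exists pz, code_leak (prod4 W) pz (enc (c n)) <= C / n%:R := svalP (cid (codes n)).
exists c; split.
  apply/cvgrPdist_le => e e0; near=> n.
  have n0 : (0 < n)%N by near: n; exact: nbhs_infty_gt.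
  have nC : C / e <= n%:R by near: n; exact: nbhs_infty_ger.
  rewrite sub0r normrN ger0_norm ?code_Pe_ge0 //; have [le _] := Hc n n0.
  by apply: le_trans le _; rewrite ler_pdivrMr ?ltr0n // mulrC -ler_pdivrMr.
(* Obtained from [ln M <= (1 + n r) ln 2] together with [(1 + (1 + n r) ln 2) / n <= 1 + (1 + r) ln
   2] for [n >= 1]. *)
pose C' := 2 * C * (1 + (1 + r) * ln 2) / ln 2.
have l2 := ln2_gt0 R.
have C'0 : 0 <= C'.
  by rewrite divr_ge0 ?mulr_ge0 ?addr_ge0 ?(ltW l2) // mulr_ge0 ?addr_ge0 // ltW.
apply: (limn_einf_ge C'0) => n n0.
have nR : 0 < n%:R :> R by rewrite ltr0n.
have n1 : 1 <= n%:R :> R by rewrite ler1n.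
have [_ [pz leak_le]] := Hc n n0.
have M0 := nmsg_gt0 n r; have MR : 0 < (nmsg n r)%:R :> R by rewrite ltr0n.
rewrite [leRHS]mulrC ler_pdivlMr //; apply: le_trans (code_equiv_ge (c n) W0 W1 M0 pz).
have lM : n%:R * r <= log2 (nmsg n r)%:R.
  by rewrite -[leLHS]log2_exp2 /log2 ler_pM2r ?invr_gt0 // ler_ln ?posrE ?exp2_gt0 // nmsg_ge.
have lM0 : 0 <= ln (nmsg n r)%:R :> R by rewrite ln_ge0 // ler1n.
have lM2 : ln (nmsg n r)%:R <= (1 + n%:R * r) * ln 2.
  apply: (@le_trans _ _ (ln (2 * exp2 (n%:R * r)))).
    by rewrite ler_ln ?posrE ?mulr_gt0 ?exp2_gt0 // nmsg_le.
  by rewrite lnM ?posrE ?exp2_gt0 // /exp2 ln_powR mulrDl mul1r.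
rewrite mulrBl lerB //; first by rewrite mulrC.
rewrite divfK ?gt_eqF //.
apply: (@le_trans _ _ ((1 + (1 + n%:R * r) * ln 2) / ln 2 * (2 * (C / n%:R)))).
  have leak0 : 0 <= code_leak (prod4 W) pz (enc (c n)).
    by rewrite mulr_ge0 ?invr_ge0 ?ler0n // sumr_ge0 // => *; rewrite sumr_ge0.
  apply: ler_pM.
  - by rewrite divr_ge0 ?addr_ge0 // ltW.
  - exact: mulr_ge0.
  - by rewrite ler_pM2r ?invr_gt0 // lerD2l.
  - by rewrite ler_pM2l.
rewrite /C' (_ : _ * (2 * (C / n%:R)) = 2 * C / ln 2 * ((1 + (1 + n%:R * r) * ln 2) / n%:R)); last first.
  by field; rewrite !gt_eqF.
rewrite [leRHS](_ : _ = 2 * C / ln 2 * (1 + (1 + r) * ln 2)); last by ring.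
rewrite ler_wpM2l ?divr_ge0 ?mulr_ge0 ?(ltW l2) // ler_pdivrMr //.
rewrite -subr_ge0 (_ : _ - _ = (n%:R - 1) * (1 + ln 2)); last by ring.
by rewrite mulr_ge0 ?subr_ge0 ?addr_ge0 // ltW.
Unshelve. all: by end_near. Qed.

(** At rate zero there is exactly one message: a constant codeword is decoded without error and
    leaks nothing. This settles the case where the lower bound is not positive. *)
Lemma achievable0 : achievable W 0.
Proof.
apply: (@achievable_of_codes 0 0) => // n n0.
pose m0 : 'I_(nmsg n (0 : R)) := Ordinal (nmsg_gt0 n (0 : R)).
have m0E (m : 'I_(nmsg n (0 : R))) : m = m0.
  apply: val_inj => /=; apply/eqP; rewrite -leqn0 -ltnS.
  apply: leq_trans (ltn_ord m) _.
  by rewrite /nmsg mulr0 powRr0 ceil1.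
pose xn := [tuple x0 | i < n].
exists (chZ (prod4 W) xn), (fun _ x => (x == xn)%:R), (fun=> Some m0), (fun=> Some m0).
have sumx (F : n.-tuple X -> R) : \sum_x (x == xn)%:R * F x = F xn.
  rewrite (bigD1 xn) //= eqxx mul1r [X in _ + X]big1 ?addr0 // => x /negbTE ->.
  by rewrite mul0r.
split=> [m x|m|]; first by rewrite ler0n.
  by have := sumx (fun=> 1); under eq_bigr do rewrite mulr1.
rewrite mul0r /code_error [X in _ * X + _]big1 => [|m _].
  rewrite mulr0 add0r /code_leak big1 ?mulr0 // => m _.
  by apply: big1 => z _; rewrite sumx subrr normr0.
apply: big1 => x _; rewrite big1 ?mulr0 // => y1 _; apply: big1 => y2 _; apply: big1 => z _.
by rewrite (m0E m) eqxx mulr0.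
Qed.

End Achievability.

(** * Single-letter information quantities *)

Lemma sum_pick (R : nmodType) (A : finType) (a : A) (F : A -> R) :
  (forall x, x != a -> F x = 0) -> \sum_x F x = F a.
Proof. by move=> F0; rewrite (bigD1 a) //= big1 ?addr0. Qed.

Lemma pushfE (R : realType) (T A : finType) (P : T -> R) (f : T -> A) a :
  pushf P f a = \sum_t if f t == a then P t else 0.
Proof. by rewrite /pushf big_mkcond. Qed.

Lemma pushf_inj (R : realType) (A B : finType) (p : A -> R) (h : A -> B) a :
  injective h -> pushf p h (h a) = p a.
Proof.
by move=> hi; rewrite /pushf (eq_bigl (pred1 a)) ?big_pred1_eq // => x; rewrite /= inj_eq.
Qed.

Section LayerInformation.
Variables (R : realType) (Q V0 V Y T : finType) (P : T -> R) (g : T -> Q * (V0 * (V * Y))).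
Variables (pq : Q -> R) (k0 : Q -> V0 -> R) (kk : V0 -> V -> R) (jj : V0 -> V -> Y -> R).
Variables (c : V0 -> Y -> R) (m : Q -> Y -> R).
Hypotheses (pq0 : forall q, 0 <= pq q).
Hypotheses (k00 : forall q v0, 0 <= k0 q v0) (k01 : forall q, \sum_v0 k0 q v0 = 1).
Hypotheses (kk1 : forall v0, \sum_v kk v0 v = 1).
Hypotheses (jj0 : forall v0 v y, 0 <= jj v0 v y) (jjE : forall v0 v, \sum_y jj v0 v y = kk v0 v).
Hypotheses (cE : forall v0 y, c v0 y = \sum_v jj v0 v y).
Hypotheses (mE : forall q y, m q y = \sum_v0 k0 q v0 * c v0 y).
Hypothesis Pg : forall q v0 v y, pushf P g (q, (v0, (v, y))) = layer_law pq k0 jj q v0 v y.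

Let law_input q v0 v :
  pushf (pushf P g) (fun a => (a.2.1, a.2.2.1, a.1)) (v0, v, q) = pq q * k0 q v0 * kk v0 v.
Proof.
rewrite pushfE sum_prod (@sum_pick _ _ q) => [|q' /negbTE h]; last first.
  by apply: big1 => a _; rewrite !xpair_eqE h andbF.
rewrite sum_prod (@sum_pick _ _ v0) => [|v0' /negbTE h]; last first.
  by apply: big1 => a _; rewrite !xpair_eqE h.
rewrite sum_prod (@sum_pick _ _ v) => [|v' /negbTE h]; last first.
  by apply: big1 => a _; rewrite !xpair_eqE h andbF.
rewrite -jjE mulr_sumr; apply: eq_bigr => y _.
by rewrite eqxx Pg.
Qed.

Let law_output q y :
  pushf (pushf P g) (fun a => (a.2.2.2, a.1)) (y, q) = pq q * m q y.
Proof.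
rewrite pushfE sum_prod (@sum_pick _ _ q) => [|q' /negbTE h]; last first.
  by apply: big1 => a _; rewrite !xpair_eqE h andbF.
rewrite sum_prod mE mulr_sumr; apply: eq_bigr => v0 _.
rewrite sum_prod cE !mulr_sumr; apply: eq_bigr => v _.
rewrite (@sum_pick _ _ y) => [|y' /negbTE h]; last by rewrite xpair_eqE h.
by rewrite eqxx Pg /layer_law -mulrA.
Qed.

Let law_time q : pushf (pushf P g) fst q = pq q.
Proof.
rewrite pushfE sum_prod (@sum_pick _ _ q) => [|q' /negbTE h]; last first.
  by apply: big1 => a _; rewrite h.
transitivity (\sum_v0 pq q * k0 q v0); last by rewrite -mulr_sumr k01 mulr1.
rewrite sum_prod; apply: eq_bigr => v0 _; transitivity (\sum_v pq q * k0 q v0 * kk v0 v).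
  rewrite sum_prod; apply: eq_bigr => v _; rewrite -jjE mulr_sumr; apply: eq_bigr => y _.
  by rewrite eqxx Pg.
by rewrite -mulr_sumr kk1 mulr1.
Qed.

(** All four entropies are expectations under the same pushforward by [g], so their logarithms
    combine inside one sum, where the factors p(q) and p(v0 | q) cancel. *)
Lemma cMI_layer :
  cMI P (fun t => ((g t).2.1, (g t).2.2.1)) (fun t => (g t).2.2.2) (fun t => (g t).1) =
  rate_all pq k0 kk jj m.
Proof.
rewrite /cMI.
rewrite (Ent_comp P g (fun a => (a.2.1, a.2.2.1, a.1))) (Ent_comp P g (fun a => (a.2.2.2, a.1))).
rewrite (Ent_comp P g (fun a => (a.2.1, a.2.2.1, a.2.2.2, a.1))) (Ent_comp P g fst) !EntE.
rewrite /rate_all sum_quad !opprK -!sumrN -!big_split /=.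
apply: eq_bigr => -[q [v0 [v y]]] _ /=.
rewrite law_input law_output law_time.
have -> : pushf (pushf P g) (fun a => (a.2.1, a.2.2.1, a.2.2.2, a.1)) (v0, v, y, q) =
    layer_law pq k0 jj q v0 v y.
  rewrite -Pg (@pushf_inj _ _ _ (pushf P g) (fun a => (a.2.1, a.2.2.1, a.2.2.2, a.1)) (q, (v0, (v, y)))) //.
  by move=> [q1 [a1 [b1 c1]]] [q2 [a2 [b2 c2]]] /= [-> -> -> ->].
rewrite Pg; have [h|h] := eqVneq (layer_law pq k0 jj q v0 v y) 0.
  by rewrite h !mul0r oppr0 !addr0.
have lp : 0 < layer_law pq k0 jj q v0 v y by rewrite lt_neqAle eq_sym h layer_law_ge0.
have [jp kp cp mp] := layer_pos k00 jj0 jjE cE mE lp.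
move: (h); rewrite {1}/layer_law !mulf_eq0 !negb_or => /andP[/andP[pn kn] _].
have pp : 0 < pq q by rewrite lt_neqAle eq_sym pn pq0.
have k0p : 0 < k0 q v0 by rewrite lt_neqAle eq_sym kn k00.
have -> : log2 (layer_law pq k0 jj q v0 v y) = log2 (pq q) + log2 (k0 q v0) + log2 (jj v0 v y).
  by rewrite !log2M ?mulr_gt0.
rewrite log2_div ?mulr_gt0 // !log2M ?mulr_gt0 //.
by move: (layer_law _ _ _ _ _ _ _) => l; ring.
Qed.

End LayerInformation.

Section MarkovCondition.
Variables (R : realType) (V0 V1 V2 X Z T : finType) (P : T -> R) (g : T -> V0 * (V1 * (V2 * Z))).
Variables (p0 : V0 -> R) (k12 : V0 -> V1 -> V2 -> R) (kX : V0 -> V1 -> V2 -> X -> R).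
Variable (ch : X -> Z -> R).
Hypotheses (p00 : forall v0, 0 <= p0 v0).
Hypotheses (k120 : forall v0 v1 v2, 0 <= k12 v0 v1 v2).
Hypotheses (kX0 : forall v0 v1 v2 x, 0 <= kX v0 v1 v2 x).
Hypotheses (ch0 : forall x z, 0 <= ch x z).

Local Notation o12 := (outj k12 kX ch).
Local Notation o1 := (outj1 k12 kX ch).
Local Notation o2 := (outj2 k12 kX ch).
Local Notation o0 := (outj0 k12 kX ch).

Hypothesis Pg : forall v0 v1 v2 z, pushf P g (v0, (v1, (v2, z))) = p0 v0 * o12 v0 v1 v2 z.

Let law_z v0 z : pushf (pushf P g) (fun a => (a.2.2.2, a.1)) (z, v0) = p0 v0 * o0 v0 z.
Proof.
rewrite pushfE sum_prod (@sum_pick _ _ v0) => [|v0' /negbTE h]; last first.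
  by apply: big1 => a _; rewrite !xpair_eqE h andbF.
rewrite sum_prod mulr_sumr; apply: eq_bigr => v1 _.
rewrite sum_prod mulr_sumr; apply: eq_bigr => v2 _.
rewrite (@sum_pick _ _ z) => [|z' /negbTE h]; last by rewrite xpair_eqE h.
by rewrite eqxx Pg.
Qed.

Let law_1z v0 v1 z : pushf (pushf P g) (fun a => (a.2.1, a.2.2.2, a.1)) (v1, z, v0) = p0 v0 * o1 v0 v1 z.
Proof.
rewrite pushfE sum_prod (@sum_pick _ _ v0) => [|v0' /negbTE h]; last first.
  by apply: big1 => a _; rewrite !xpair_eqE h andbF.
rewrite sum_prod (@sum_pick _ _ v1) => [|v1' /negbTE h]; last first.
  by apply: big1 => a _; rewrite !xpair_eqE h.
rewrite sum_prod mulr_sumr; apply: eq_bigr => v2 _.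
rewrite (@sum_pick _ _ z) => [|z' /negbTE h]; last by rewrite !xpair_eqE h andbF.
by rewrite eqxx Pg.
Qed.

Let law_2z v0 v2 z : pushf (pushf P g) (fun a => (a.2.2.1, a.2.2.2, a.1)) (v2, z, v0) = p0 v0 * o2 v0 v2 z.
Proof.
rewrite pushfE sum_prod (@sum_pick _ _ v0) => [|v0' /negbTE h]; last first.
  by apply: big1 => a _; rewrite !xpair_eqE h andbF.
rewrite sum_prod mulr_sumr; apply: eq_bigr => v1 _.
rewrite sum_prod (@sum_pick _ _ v2) => [|v2' /negbTE h]; last first.
  by apply: big1 => a _; rewrite !xpair_eqE h.
rewrite (@sum_pick _ _ z) => [|z' /negbTE h]; last by rewrite !xpair_eqE h andbF.
by rewrite eqxx Pg.
Qed.

(* The hypothesis says [I(V1; V2 | V0, Z) <= 0]. *)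
Lemma markov_of_entropy :
  Ent P (fun t => ((g t).2.1, (g t).2.2.2, (g t).1)) +
  Ent P (fun t => ((g t).2.2.1, (g t).2.2.2, (g t).1)) <=
  Ent P (fun t => ((g t).2.1, (g t).2.2.1, (g t).2.2.2, (g t).1)) +
  Ent P (fun t => ((g t).2.2.2, (g t).1)) ->
  forall v0 v1 v2 z, 0 < p0 v0 -> o12 v0 v1 v2 z * o0 v0 z = o1 v0 v1 z * o2 v0 v2 z.
Proof.
rewrite (Ent_comp P g (fun a => (a.2.1, a.2.2.2, a.1))) (Ent_comp P g (fun a => (a.2.2.1, a.2.2.2, a.1))).
rewrite (Ent_comp P g (fun a => (a.2.1, a.2.2.1, a.2.2.2, a.1))) (Ent_comp P g (fun a => (a.2.2.2, a.1))).
rewrite !EntE => ent_le v0 v1 v2 z p0p.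
pose p (a : V0 * (V1 * (V2 * Z))) := p0 a.1 * o12 a.1 a.2.1 a.2.2.1 a.2.2.2.
(* [q] is the law that keeps the marginals with [v0] and [z] but makes [v1] and [v2] independent
   given both. The entropy inequality says that the divergence of [p] from [q] is at most 0, so the
   equality case of Gibbs applies. *)
pose q (a : V0 * (V1 * (V2 * Z))) :=
  p0 a.1 * (o1 a.1 a.2.1 a.2.2.2 * o2 a.1 a.2.2.1 a.2.2.2 / o0 a.1 a.2.2.2).
have o120 := outj_ge0 k120 kX0 ch0; have o10 := outj1_ge0 k120 kX0 ch0.
have o20 := outj2_ge0 k120 kX0 ch0; have o00 := outj0_ge0 k120 kX0 ch0.
have pE a : pushf P g a = p a by case: a => a1 [a2 [a3 a4]]; rewrite Pg.
have pos a : 0 < p a -> [/\ 0 < p0 a.1, 0 < o12 a.1 a.2.1 a.2.2.1 a.2.2.2,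
    0 < o1 a.1 a.2.1 a.2.2.2, 0 < o2 a.1 a.2.2.1 a.2.2.2 & 0 < o0 a.1 a.2.2.2].
  move=> pa; have : p a != 0 by rewrite gt_eqF.
  rewrite mulf_eq0 negb_or => /andP[pn on].
  have op : 0 < o12 a.1 a.2.1 a.2.2.1 a.2.2.2 by rewrite lt_neqAle eq_sym on o120.
  have op1 : 0 < o1 a.1 a.2.1 a.2.2.2.
    by rewrite (lt_le_trans op) // /outj1 (bigD1 a.2.2.1) //= lerDl sumr_ge0.
  split => //; first by rewrite lt_neqAle eq_sym pn p00.
    by rewrite (lt_le_trans op) // /outj2 (bigD1 a.2.1) //= lerDl sumr_ge0.
  by rewrite (lt_le_trans op1) // outj1_le_outj0.
have qp : \sum_a q a <= \sum_a p a.
  apply: eq_imp_ler; rewrite !sum_prod; apply: eq_bigr => a1 _.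
  transitivity (\sum_z p0 a1 * o0 a1 z).
    rewrite sum_prod; under eq_bigr do rewrite sum_prod exchange_big /=.
    rewrite exchange_big; apply: eq_bigr => a4 _ /=.
    under eq_bigr => a2 _.
      rewrite /q /= -mulr_sumr -mulr_suml -mulr_sumr -outj0E2.
      over.
    rewrite -mulr_sumr -mulr_suml -mulr_suml; congr (_ * _); rewrite -/(outj0 _ _ _ _ _).
    by have [->|h] := eqVneq (o0 a1 a4) 0; [rewrite !mul0r|rewrite mulfK].
  rewrite sum_prod; under [RHS]eq_bigr do rewrite sum_prod exchange_big /=.
  rewrite exchange_big; apply: eq_bigr => a4 _ /=.
  rewrite mulr_sumr exchange_big /=.
  by rewrite exchange_big /=; apply: eq_bigr => a2 _; rewrite /p /= mulr_sumr.
have ent : \sum_a p a * log2 (p a / q a) <= 0.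
  suff -> : \sum_a p a * log2 (p a / q a) =
    (- \sum_t pushf P g t * log2 (pushf (pushf P g) (fun a => (a.2.1, a.2.2.2, a.1)) (t.2.1, t.2.2.2, t.1)) +
     - \sum_t pushf P g t * log2 (pushf (pushf P g) (fun a => (a.2.2.1, a.2.2.2, a.1)) (t.2.2.1, t.2.2.2, t.1))) -
    (- \sum_t pushf P g t * log2 (pushf (pushf P g) (fun a => (a.2.1, a.2.2.1, a.2.2.2, a.1))
         (t.2.1, t.2.2.1, t.2.2.2, t.1)) +
     - \sum_t pushf P g t * log2 (pushf (pushf P g) (fun a => (a.2.2.2, a.1)) (t.2.2.2, t.1))).
    by rewrite subr_le0.
  rewrite opprD !opprK -!sumrN -!big_split /=; apply: eq_bigr => a _.
  rewrite (@pushf_inj _ _ _ (pushf P g) (fun a => (a.2.1, a.2.2.1, a.2.2.2, a.1)) a); last first.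
    by move=> [q1 [a1 [b1 c1]]] [q2 [a2 [b2 c2]]] /= [-> -> -> ->].
  rewrite law_z law_1z law_2z !pE.
  have [h|h] := eqVneq (p a) 0; first by rewrite h !mul0r oppr0 !addr0.
  have pap : 0 < p a by rewrite lt_neqAle eq_sym h mulr_ge0.
  have [pa op op1 op2 op0] := pos a pap.
  have qa : 0 < q a by rewrite mulr_gt0 // divr_gt0 // mulr_gt0.
  have lq : log2 (q a) = log2 (p0 a.1) + (log2 (o1 a.1 a.2.1 a.2.2.2) +
      log2 (o2 a.1 a.2.2.1 a.2.2.2) - log2 (o0 a.1 a.2.2.2)).
    rewrite /q (log2M pa) ?divr_gt0 ?mulr_gt0 //; congr (_ + _).
    by rewrite log2_div ?mulr_gt0 // log2M.
  rewrite log2_div // lq.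
  rewrite !(log2M pa) //.
  by move: (p a) (log2 (p a)) => l1 l2; ring.
have p_ge0 a : 0 <= p a by rewrite mulr_ge0.
have q_ge0 a : 0 <= q a by rewrite mulr_ge0 // divr_ge0 // mulr_ge0.
have q_gt0 a : 0 < p a -> 0 < q a.
  by move=> /pos[pa op op1 op2 op0]; rewrite mulr_gt0 // divr_gt0 // mulr_gt0.
have := gibbs_eq p_ge0 q_ge0 q_gt0 qp ent (v0, (v1, (v2, z))).
rewrite /p /q /=; have /mulfI inj : p0 v0 != 0 by rewrite gt_eqF.
move=> /inj ->; have [h|h] := eqVneq (o0 v0 z) 0; last by rewrite mulfVK.
have -> : o1 v0 v1 z = 0.
  by apply/eqP; rewrite eq_le o10 andbT -h outj1_le_outj0.
by rewrite h mulr0 mul0r.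
Qed.

End MarkovCondition.

(** * Marginals of the single-letter joint law *)

Section JointLaw.
Variables (R : realType) (Q V0 V1 V2 X Y1 Y2 Z : finType).
Variables (pQV : Q -> V0 -> R) (pV : V0 -> V1 -> V2 -> R) (pX : V0 -> V1 -> V2 -> X -> R).
Variables (W : X -> Y1 -> Y2 -> Z -> R) (pq : Q -> R) (k0 : Q -> V0 -> R).
Hypothesis pqk0 : forall q v0, pq q * k0 q v0 = pQV q v0.

Local Notation P := (sl_joint pQV pV pX W).
Local Notation Om := (Q * V0 * V1 * V2 * X * Y1 * Y2 * Z)%type.

(** Collapses the outermost sum to its only letter compatible with the event defining the
    pushforward. *)
Ltac pick_only a :=
  rewrite (@sum_pick _ _ a); last by
    let h := fresh in move=> ? /negbTE h; do ?(apply: big1 => ? _); rewrite /= !xpair_eqE h ?andbF.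

Lemma joint_law_V1Y1 q v0 v1 y :
  pushf P (fun t : Om => (t.1.1.1.1.1.1.1, (t.1.1.1.1.1.1.2, (t.1.1.1.1.1.2, t.1.1.2)))) (q, (v0, (v1, y))) =
  layer_law pq k0 (outj1 pV pX (chY1 W)) q v0 v1 y.
Proof.
rewrite pushfE !sum_prod; pick_only q; pick_only v0; pick_only v1.
rewrite /layer_law /outj1 mulr_sumr; apply: eq_bigr => v2 _.
rewrite /outj /out !mulr_sumr; apply: eq_bigr => x _; pick_only y.
rewrite /chY1 !mulr_sumr; apply: eq_bigr => y2 _; rewrite !mulr_sumr; apply: eq_bigr => z _.
by rewrite eqxx /= -pqk0 !mulrA.
Qed.

Lemma joint_law_V2Y2 q v0 v2 y :
  pushf P (fun t : Om => (t.1.1.1.1.1.1.1, (t.1.1.1.1.1.1.2, (t.1.1.1.1.2, t.1.2)))) (q, (v0, (v2, y))) =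
  layer_law pq k0 (outj2 pV pX (chY2 W)) q v0 v2 y.
Proof.
rewrite pushfE !sum_prod; pick_only q; pick_only v0.
rewrite /layer_law /outj2 mulr_sumr; apply: eq_bigr => v1 _; pick_only v2.
rewrite /outj /out !mulr_sumr; apply: eq_bigr => x _.
rewrite /chY2 !mulr_sumr; apply: eq_bigr => y1 _; pick_only y; rewrite !mulr_sumr; apply: eq_bigr => z _.
by rewrite eqxx /= -pqk0 !mulrA.
Qed.

Lemma joint_law_V1Z q v0 v1 z :
  pushf P (fun t : Om => (t.1.1.1.1.1.1.1, (t.1.1.1.1.1.1.2, (t.1.1.1.1.1.2, t.2)))) (q, (v0, (v1, z))) =
  layer_law pq k0 (outj1 pV pX (chZ W)) q v0 v1 z.
Proof.
rewrite pushfE !sum_prod; pick_only q; pick_only v0; pick_only v1.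
rewrite /layer_law /outj1 mulr_sumr; apply: eq_bigr => v2 _.
rewrite /outj /out !mulr_sumr; apply: eq_bigr => x _.
rewrite /chZ !mulr_sumr; apply: eq_bigr => y1 _; rewrite !mulr_sumr; apply: eq_bigr => y2 _.
by pick_only z; rewrite eqxx /= -pqk0 !mulrA.
Qed.

Lemma joint_law_V2Z q v0 v2 z :
  pushf P (fun t : Om => (t.1.1.1.1.1.1.1, (t.1.1.1.1.1.1.2, (t.1.1.1.1.2, t.2)))) (q, (v0, (v2, z))) =
  layer_law pq k0 (outj2 pV pX (chZ W)) q v0 v2 z.
Proof.
rewrite pushfE !sum_prod; pick_only q; pick_only v0.
rewrite /layer_law /outj2 mulr_sumr; apply: eq_bigr => v1 _; pick_only v2.
rewrite /outj /out !mulr_sumr; apply: eq_bigr => x _.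
rewrite /chZ !mulr_sumr; apply: eq_bigr => y1 _; rewrite !mulr_sumr; apply: eq_bigr => y2 _.
by pick_only z; rewrite eqxx /= -pqk0 !mulrA.
Qed.

Lemma joint_law_V1V2Z v0 v1 v2 z :
  pushf P (fun t : Om => (t.1.1.1.1.1.1.2, (t.1.1.1.1.1.2, (t.1.1.1.1.2, t.2)))) (v0, (v1, (v2, z))) =
  (\sum_q pQV q v0) * outj pV pX (chZ W) v0 v1 v2 z.
Proof.
rewrite pushfE !sum_prod mulr_suml; apply: eq_bigr => q _.
pick_only v0; pick_only v1; pick_only v2.
rewrite /outj /out !mulr_sumr; apply: eq_bigr => x _.
rewrite /chZ !mulr_sumr; apply: eq_bigr => y1 _; rewrite !mulr_sumr; apply: eq_bigr => y2 _.
by pick_only z; rewrite eqxx /= !mulrA.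
Qed.

End JointLaw.

(** Normalization forces an alphabet to be nonempty; this supplies the default letters for the
    fallback encoder and conditional law. *)
Lemma sum1_inhabited (R : realType) (A : finType) (F : A -> R) : \sum_a F a = 1 -> A.
Proof.
move=> F1; case: (pickP (fun _ : A => true)) => [a _ //|noA].
by move: F1; rewrite big_pred0 // => /esym/eqP; rewrite oner_eq0.
Qed.

Theorem theorem1 (R : realType) (X Y1 Y2 Z : finType)
  (W : X -> Y1 -> Y2 -> Z -> R) (HW : is_channel W)
  (Q V0 V1 V2 : finType)
  (pQV : Q -> V0 -> R) (pV : V0 -> V1 -> V2 -> R) (pX : V0 -> V1 -> V2 -> X -> R)
  (HpQV0 : forall q v0, 0 <= pQV q v0)
  (HpQV1 : \sum_(a : Q * V0) pQV a.1 a.2 = 1)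
  (HpV0 : forall v0 v1 v2, 0 <= pV v0 v1 v2)
  (HpV1 : forall v0, \sum_(a : V1 * V2) pV v0 a.1 a.2 = 1)
  (HpX0 : forall v0 v1 v2 x, 0 <= pX v0 v1 v2 x)
  (HpX1 : forall v0 v1 v2, \sum_(x : X) pX v0 v1 v2 x = 1) :
  let P := sl_joint pQV pV pX W in
  let q  := fun t : Q * V0 * V1 * V2 * X * Y1 * Y2 * Z => t.1.1.1.1.1.1.1 in
  let v0 := fun t : Q * V0 * V1 * V2 * X * Y1 * Y2 * Z => t.1.1.1.1.1.1.2 in
  let v1 := fun t : Q * V0 * V1 * V2 * X * Y1 * Y2 * Z => t.1.1.1.1.1.2 in
  let v2 := fun t : Q * V0 * V1 * V2 * X * Y1 * Y2 * Z => t.1.1.1.1.2 in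
  let y1 := fun t : Q * V0 * V1 * V2 * X * Y1 * Y2 * Z => t.1.1.2 in
  let y2 := fun t : Q * V0 * V1 * V2 * X * Y1 * Y2 * Z => t.1.2 in
  let z  := fun t : Q * V0 * V1 * V2 * X * Y1 * Y2 * Z => t.2 in
  cMI P (fun t => (v1 t, v2 t)) z v0
    <= cMI P v1 z v0 + cMI P v2 z v0 - cMI P v1 v2 v0 ->
  ((Num.min (cMI P (fun t => (v0 t, v1 t)) y1 q - cMI P (fun t => (v0 t, v1 t)) z q)
            (cMI P (fun t => (v0 t, v2 t)) y2 q - cMI P (fun t => (v0 t, v2 t)) z q))%:E
   <= secrecy_capacity W)%E.
Proof.
move=> P q v0 v1 v2 y1 y2 z hyp.
have [q0 v00] := sum1_inhabited HpQV1.
have [v10 v20] := sum1_inhabited (HpV1 v00).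
have x0 := sum1_inhabited (HpX1 v00 v10 v20).
have [W0 Wsum] := HW.
have W1 x : \sum_y1 \sum_y2 \sum_z W x y1 y2 z = 1 by rewrite -[RHS](Wsum x) !sum_prod.
have pV1 w0 : \sum_w1 \sum_w2 pV w0 w1 w2 = 1 by rewrite -[RHS](HpV1 w0) !sum_prod.
pose pq a := \sum_w pQV a w.
have pq0 a : 0 <= pq a by apply: sumr_ge0.
have pq1 : \sum_a pq a = 1 by rewrite -[RHS]HpQV1 sum_prod.
(* Where p(q) vanishes, a point mass at [v00] keeps [k0] a conditional pmf without changing the
   product with [pq]. *)
pose k0 a w : R := if pq a == 0 then (w == v00)%:R else pQV a w / pq a.
have k00 a w : 0 <= k0 a w by rewrite /k0; case: ifP => _; rewrite ?ler0n ?divr_ge0.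
have k01 a : \sum_w k0 a w = 1.
  rewrite /k0; have [h|h] := boolP (pq a == 0).
    by rewrite (@sum_pick _ _ v00) ?eqxx // => w /negbTE ->.
  by rewrite -mulr_suml mulfV.
have pqk0 a w : pq a * k0 a w = pQV a w.
  rewrite /k0; have [/eqP h|h] := boolP (pq a == 0); last by rewrite mulrCA mulfV ?mulr1.
  by rewrite h mul0r; move/psumr_eq0P : h => ->.
have cY1 x : \sum_y chY1 W x y = 1 by exact: W1.
have cY2 x : \sum_y chY2 W x y = 1 by rewrite -[RHS](W1 x); exact: exchange_big.
have markov a w0 w1 w2 c : 0 < pq a -> 0 < k0 a w0 ->
  outj pV pX (chZ W) w0 w1 w2 c * outj0 pV pX (chZ W) w0 c =
  outj1 pV pX (chZ W) w0 w1 c * outj2 pV pX (chZ W) w0 w2 c.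
  move=> pa ka.
  (* Once the conditional informations are expanded, all entropies not involving [z] cancel and the
     assumption becomes the entropy inequality expected here. The cloud law is p(v0), positive as
     soon as one p(q, v0) is. *)
  apply: (markov_of_entropy (fun w => sumr_ge0 _ (fun a _ => HpQV0 a w)) HpV0 HpX0 (chZ_ge0 W0)
    (joint_law_V1V2Z pQV pV pX W)); first by move: hyp; rewrite /cMI /=; lra.
  by rewrite (bigD1 a) //= -pqk0 ltr_wpDr ?mulr_gt0 // sumr_ge0.
have I1 : cMI P (fun t => (v0 t, v1 t)) y1 q = rate1 pq k0 pV pX (chY1 W).
  exact: (cMI_layer pq0 k00 k01 pV1 (outj1_ge0 HpV0 HpX0 (chY1_ge0 W0))
    (outj1_sum pV HpX1 cY1) (fun _ _ => erefl) (fun _ _ => erefl) (joint_law_V1Y1 pV pX W pqk0)).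
have IZ1 : cMI P (fun t => (v0 t, v1 t)) z q = rate1 pq k0 pV pX (chZ W).
  exact: (cMI_layer pq0 k00 k01 pV1 (outj1_ge0 HpV0 HpX0 (chZ_ge0 W0))
    (outj1_sum pV HpX1 (chZ_sum1 W1)) (fun _ _ => erefl) (fun _ _ => erefl) (joint_law_V1Z pV pX W pqk0)).
have I2 : cMI P (fun t => (v0 t, v2 t)) y2 q = rate2 pq k0 pV pX (chY2 W).
  exact: (cMI_layer pq0 k00 k01 (fun w => marg2_sum1 (pV1 w)) (outj2_ge0 HpV0 HpX0 (chY2_ge0 W0))
    (outj2_sum pV HpX1 cY2) (outj0E2 pV pX (chY2 W)) (fun _ _ => erefl) (joint_law_V2Y2 pV pX W pqk0)).
have IZ2 : cMI P (fun t => (v0 t, v2 t)) z q = rate2 pq k0 pV pX (chZ W).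
  exact: (cMI_layer pq0 k00 k01 (fun w => marg2_sum1 (pV1 w)) (outj2_ge0 HpV0 HpX0 (chZ_ge0 W0))
    (outj2_sum pV HpX1 (chZ_sum1 W1)) (outj0E2 pV pX (chZ W)) (fun _ _ => erefl) (joint_law_V2Z pV pX W pqk0)).
rewrite I1 IZ1 I2 IZ2; set d1 := _ - _; set d2 := _ - _.
have ub r : achievable W r -> (r%:E <= secrecy_capacity W)%E.
  by move=> ach; apply: ereal_sup_ubound => /=; exists r.
(* The coding argument needs a nonnegative rate strictly below the minimum, which exists only if the
   minimum is positive. *)
have [m0|m0] := leP (Num.min d1 d2) 0.
  apply: (@le_trans _ _ 0%:E); first by rewrite lee_fin.
  exact/ub/achievable0.
apply/lee_addgt0Pr => e e0.
(* Truncation at 0 keeps the rate admissible, and [r] stays within [e] of the minimum. *)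
pose r := Num.max 0 (Num.min d1 d2 - e).
have r0 : 0 <= r by rewrite le_max lexx.
have rm : r < Num.min d1 d2 by rewrite gt_max m0 /= gtrBl.
have [r1 r2] : r < d1 /\ r < d2 by apply/andP; rewrite -lt_min.
have [C C0 codes] := nletter_code pq0 pq1 k00 k01 HpV0 pV1 HpX0 HpX1 W0 W1 markov x0 r0 r1 r2.
rewrite -leeBlDr // -EFinB.
apply: le_trans (ub r (achievable_of_codes W0 W1 r0 C0 codes)).
by rewrite lee_fin le_max lexx orbT.
Qed.
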